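(* Let $d\in\mathbb{N}$. The maximal ideal space $M_{A_{\mathrm{sym}}(\mathbb{D}^d)}$ of $A_{\mathrm{sym}}(\mathbb{D}^d)$, with the Gelfand topology, is homeomorphic to $\overline{\mathbb{D}}^d/\!\sim$ with the quotient topology.
   Context: $\mathbb{N}=\{1,2,3,\dots\}$, $\mathbb{D}=\{z\in\mathbb{C}:|z|<1\}$, and $\overline{\mathbb{D}}$ is its closure in $\mathbb{C}$. For $d\in\mathbb{N}$, $A(\mathbb{D}^d)$ is the polydisc algebra of all functions $f:\overline{\mathbb{D}}^d\to\mathbb{C}$ that are holomorphic in $\mathbb{D}^d$ and continuous on $\overline{\mathbb{D}}^d$, a Banach algebra with pointwise operations and the norm $\|f\|_\infty=\sup_{\mathbf{z}\in\mathbb{D}^d}|f(\mathbf{z})|$. The symmetric group $S_d$ of all permutations of $\{1,\dots,d\}$ acts by $\sigma\mathbf{z}=(z_{\sigma(1)},\dots,z_{\sigma(d)})$ for $\mathbf{z}=(z_1,\dots,z_d)\in\mathbb{C}^d$. A function $f\in A(\mathbb{D}^d)$ is symmetric if $f(\sigma\mathbf{z})=f(\mathbf{z})$ for all $\mathbf{z}\in\mathbb{D}^d$ and all $\sigma\in S_d$. $A_{\mathrm{sym}}(\mathbb{D}^d)$ is the Banach subalgebra of $A(\mathbb{D}^d)$ consisting of all symmetric functions in $A(\mathbb{D}^d)$. On $\overline{\mathbb{D}}^d$, $\mathbf{z}\sim\mathbf{w}$ means that there is $\sigma\in S_d$ with $\sigma\mathbf{z}=\mathbf{w}$; this is an equivalence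 relation. The set $\overline{\mathbb{D}}^d/\!\sim$ of equivalence classes carries the quotient topology induced by the projection $\mathbf{z}\mapsto[\mathbf{z}]$ from $\overline{\mathbb{D}}^d$ with its Euclidean subspace topology. The maximal ideal space $M_{\mathcal{A}}$ of a complex unital commutative Banach algebra $\mathcal{A}$ is the set of all nontrivial (nonzero) complex homomorphisms $\varphi:\mathcal{A}\to\mathbb{C}$; its Gelfand topology is the topology induced from the weak-$*$ topology of the dual space of $\mathcal{A}$. *)

(* Defs.v *)
From HB Require Import structures.
From mathcomp Require Import all_boot all_order all_algebra all_fingroup.
From mathcomp Require Import all_classical all_reals all_analysis.
From mathcomp Require Import complex.

Set Implicit Arguments.
Unset Strict Implicit.
Unset Printing Implicit Defensive.

Import Order.TTheory GRing.Theory Num.Theory.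
Import numFieldNormedType.Exports.

Local Open Scope classical_set_scope.
Local Open Scope ring_scope.

Definition homeomorphic (X Y : topologicalType) : Prop :=
  exists (f : X -> Y) (g : Y -> X),
    [/\ cancel f g, cancel g f, continuous f & continuous g].

(* Everything below is generic in the scalar field C; the complex numbers are
   C := R[i] with R : realType. *)

(* {ptws A -> C} carries the topology of pointwise convergence. The weak-*
   topology of the dual of A is by definition the topology that it induces on
   the continuous linear functionals, and the Gelfand topology is in turn the
   one that the latter induces on characters. Hence the topology of
   [set_type (maximal_ideal_space C A)], which is the subset topology, is the
   Gelfand topology. *)
Definition maximal_ideal_space (C : numClosedFieldType) (A : comAlgType C) :
    set {ptws A -> C} :=
  [set phi | [/\ scalar (phi : A -> C),
                 {morph (phi : A -> C) : a b / a * b} &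
                 exists a, phi a != 0]].
Arguments maximal_ideal_space : clear implicits.

Definition gelfand_space (C : numClosedFieldType) (A : comAlgType C) :
    topologicalType :=
  set_type (maximal_ideal_space C A).

Section PolydiscAlgebra.
Context (C : numClosedFieldType) (d : nat).

Definition unit_disc : set C := [set z | `|z| < 1].

Definition polydisc : set 'rV[C]_d :=
  [set z | forall j, unit_disc (z ord0 j)].

Definition closed_polydisc : set 'rV[C]_d :=
  [set z | forall j, closure unit_disc (z ord0 j)].

Lemma closed_polydisc_perm (s : 'S_d) (z : closed_polydisc) :
  closed_polydisc (col_perm s (val z)).
Proof. by move=> j; rewrite mxE; exact: (set_mem (valP z)). Qed.

(* (z_1, ..., z_d) is mapped to (z_(s 1), ..., z_(s d)). *)
Definition perm_action (s : 'S_d) (z : closed_polydisc) : closed_polydisc :=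
  SigSub (mem_set (@closed_polydisc_perm s z)).

(* Complex (Frechet) differentiability at x depends only on the values of F
   near x, so the choice of F outside the open polydisc is irrelevant. *)
Definition holomorphic_in_polydisc (f : closed_polydisc -> C) : Prop :=
  exists F : 'rV[C]_d -> C,
    (forall z : closed_polydisc, polydisc (val z) -> f z = F (val z)) /\
    (forall x, polydisc x -> differentiable F x).

Definition polydisc_algebra : set (closed_polydisc -> C) :=
  [set f | holomorphic_in_polydisc f /\ continuous f].

Definition symmetric_function (f : closed_polydisc -> C) : Prop :=
  forall (s : 'S_d) (z : closed_polydisc),
    polydisc (val z) -> f (perm_action s z) = f z.

Definition sym_polydisc_algebra : {pred (closed_polydisc -> C)} :=
  mem (polydisc_algebra `&` [set f | symmetric_function f]).

Lemma sym_polydisc_algebraP (f : closed_polydisc -> C) :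
  reflect [/\ holomorphic_in_polydisc f, continuous f & symmetric_function f]
          (f \in sym_polydisc_algebra).
Proof.
by apply: (iffP idP) => [/set_mem[[? ?] ?]|[? ? ?]] //; exact/mem_set.
Qed.

Lemma sym_polydisc_algebra_subring : subring_closed sym_polydisc_algebra.
Proof.
split.
- apply/sym_polydisc_algebraP; split.
  + by exists (cst 1); split => // x _; exact: differentiable_cst.
  + by move=> z; exact: cst_continuous.
  + by [].
- move=> f g /sym_polydisc_algebraP[[F [fF dF]] cf sf].
  move=> /sym_polydisc_algebraP[[G [gG dG]] cg sg].
  apply/sym_polydisc_algebraP; split.
  + exists (F - G); split => [z zD|x xD].
      by rewrite !fctE fF// gG.
    by apply: differentiableB; [exact: dF|exact: dG].
  + by move=> z; apply: continuousB; [exact: cf|exact: cg].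
  + by move=> s z zD; rewrite !fctE sf// sg.
- move=> f g /sym_polydisc_algebraP[[F [fF dF]] cf sf].
  move=> /sym_polydisc_algebraP[[G [gG dG]] cg sg].
  apply/sym_polydisc_algebraP; split.
  + exists (F * G); split => [z zD|x xD].
      by rewrite !fctE fF// gG.
    by apply: differentiableM; [exact: dF|exact: dG].
  + by move=> z; apply: continuousM; [exact: cf|exact: cg].
  + by move=> s z zD; rewrite !fctE sf// sg.
Qed.

Lemma sym_polydisc_algebra_scaler : GRing.scaler_closed sym_polydisc_algebra.
Proof.
move=> a f /sym_polydisc_algebraP[[F [fF dF]] cf sf].
apply/sym_polydisc_algebraP; split.
- exists (a *: F); split => [z zD|x xD].
    by rewrite !fctE fF.
  by apply: differentiableZ; exact: dF.
- by move=> z; apply: continuousZr; exact: cf.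
- by move=> s z zD; rewrite !fctE sf.
Qed.

HB.instance Definition _ :=
  GRing.isSubringClosed.Build (closed_polydisc -> C) sym_polydisc_algebra
    sym_polydisc_algebra_subring.
HB.instance Definition _ :=
  GRing.isScaleClosed.Build C (closed_polydisc -> C) sym_polydisc_algebra
    sym_polydisc_algebra_scaler.

Record Asym := MkAsym {
  Asym_fun :> closed_polydisc -> C;
  Asym_funP : Asym_fun \in sym_polydisc_algebra }.

HB.instance Definition _ := [isSub for Asym_fun].
HB.instance Definition _ := [Choice of Asym by <:].
HB.instance Definition _ :=
  GRing.SubChoice_isSubComPzRing.Build _ _ Asym (subringClosedP _).
HB.instance Definition _ := [SubZmodule_isSubLmodule of Asym by <:].

Lemma closed_polydisc0 : closed_polydisc 0.
Proof.
by move=> j; apply: subset_closure; rewrite /unit_disc /= mxE normr0 ltr01.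
Qed.

Lemma Asym_oner_neq0 : (1 : Asym) != 0.
Proof.
apply/eqP => /(congr1 (fun f => Asym_fun f (SigSub (mem_set closed_polydisc0)))).
by move/eqP; rewrite /= oner_eq0.
Qed.
HB.instance Definition _ :=
  GRing.PzSemiRing_isNonZero.Build Asym Asym_oner_neq0.

Lemma Asym_scalerAl (a : C) (f g : Asym) : a *: (f * g) = (a *: f) * g.
Proof. by apply/val_inj/funext => z /=; exact: mulrA. Qed.
HB.instance Definition _ := GRing.Lmodule_isLalgebra.Build C Asym Asym_scalerAl.
HB.instance Definition _ := GRing.Lalgebra_isComAlgebra.Build C Asym.

Definition perm_equiv : rel closed_polydisc :=
  fun z w => `[< exists s : 'S_d, perm_action s z = w >].

Lemma perm_equiv_refl : reflexive perm_equiv.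
Proof.
move=> z; apply/asboolP; exists 1%g.
by apply/val_inj/rowP => j; rewrite mxE perm1.
Qed.

Lemma perm_equiv_sym : symmetric perm_equiv.
Proof.
suff H z w : perm_equiv z w -> perm_equiv w z by move=> z w; apply/idP/idP => /H.
move=> /asboolP[s <-]; apply/asboolP; exists s^-1%g.
by apply/val_inj/rowP => j; rewrite !mxE permKV.
Qed.

Lemma perm_equiv_trans : transitive perm_equiv.
Proof.
move=> w z u /asboolP[s <-] /asboolP[t <-]; apply/asboolP; exists (t * s)%g.
by apply/val_inj/rowP => j; rewrite !mxE permM.
Qed.

Canonical perm_equiv_equiv :=
  EquivRel perm_equiv perm_equiv_refl perm_equiv_sym perm_equiv_trans.

Definition polydisc_quotient : topologicalType :=
  quotient_topology {eq_quot perm_equiv_equiv}%qT.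

End PolydiscAlgebra.

Arguments unit_disc : clear implicits.
Arguments polydisc : clear implicits.
Arguments closed_polydisc : clear implicits.
Arguments polydisc_algebra : clear implicits.

(* Main.v *)
Require Import Defs.
From mathcomp Require Import all_boot all_order all_algebra all_fingroup.
From mathcomp Require Import all_classical all_reals all_analysis.
From mathcomp Require Import reals complex.
From mathcomp Require Import ring lra zify.
From mathcomp Require Import -(notations) mpoly.

(** The points of the closed polydisc give characters of the symmetric algebra
    by evaluation, and two points give the same character exactly when they lie
    in one orbit: the elementary symmetric polynomials determine the polynomial
    with roots z_1, ..., z_d, hence the multiset of its roots
    ([eval_separates]). The induced map from the quotient to the Gelfand space
    is continuous, its source is compact and its target is Hausdorff, so it is
    a homeomorphism as soon as it is onto ([gelfand_homeo]).

    Surjectivity is [char_is_eval]. Let phi be a character. A nowhere vanishing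
    element of the algebra is invertible in it, because 1/f is again
    holomorphic, continuous and symmetric; hence phi f is a value of f
    ([char_range]), and phi is automatically contractive for the sup norm. Let
    w_1, ..., w_d be the roots of the monic polynomial whose coefficients are,
    up to sign, the values of phi at the elementary symmetric functions. By the
    fundamental theorem on symmetric polynomials phi p = p(w) for every
    symmetric polynomial p. The polynomial prod_i (w_j - z_i) lies in the
    kernel of phi, so it has a zero on the closed polydisc, which forces
    |w_j| <= 1. Symmetric polynomials being uniformly dense
    ([dense_sym_poly]), phi is evaluation at w.

    Density is where holomorphy is used. By uniform continuity f(z) is close to
    f(r z) for r < 1 near 1, and averaging over the symmetric group makes an
    approximating polynomial symmetric, so it suffices to approximate a complex
    differentiable function by polynomials on a smaller polydisc. This is done
    one variable at a time ([poly_approx_dep]), by the polynomial [interp] that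
    interpolates g at the points t = rho * (2^n-th root of unity). Its error at
    z is a bounded factor times the mean over the nodes of h(t) t, with
    h(t) = (g(t) - g(z)) / (t - z), and this mean is a Riemann sum for the
    integral of h dt over a circle; Cauchy's theorem says that it tends to 0
    ([cauchy_circle]).

    Cauchy's theorem is proved without integrals. The trapezoid rule is exact
    for affine functions, and the sums over the boundaries of the cells of a
    grid add up to the sum over the boundary of the grid. Goursat's bisection
    therefore applies to the trapezoid sums themselves ([goursat]): if the sums
    around a cell do not become small as the subdivision is refined, then
    neither do those around one of its four children, relative to a quarter of
    the bound, and this contradicts differentiability at the limit point of the
    nested cells.
    The grids are images of dyadic grids of the unit square under a Lipschitz
    map, here the contraction of a circle onto a small curve around z. *)

Set Implicit Arguments.
Unset Strict Implicit.
Unset Printing Implicit Defensive.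

Import Order.TTheory GRing.Theory Num.Theory.
Import numFieldNormedType.Exports.

Local Open Scope classical_set_scope.
Local Open Scope ring_scope.

(** * Complex moduli with real values *)

Section ComplexModulus.
Context {R : realType}.
Implicit Types z w : R[i].

(** The norm of [R[i]] takes its values in [R[i]], where real-field decision
    procedures do not apply; this is the same number in [R]. *)
Definition cmod z : R := Normc.normc z.

Lemma norm_cmod z : `|z| = (cmod z)%:C%C.
Proof. by rewrite normc_def; case: z. Qed.

Lemma cmod_ge0 z : 0 <= cmod z.
Proof. by rewrite -lecR -norm_cmod normr_ge0. Qed.

Lemma cmodD z w : cmod (z + w) <= cmod z + cmod w.
Proof. by rewrite -lecR rmorphD /= -!norm_cmod ler_normD. Qed.

Lemma cmodM z w : cmod (z * w) = cmod z * cmod w.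
Proof. exact: Normc.normcM. Qed.

Lemma cmodN z : cmod (- z) = cmod z.
Proof. by apply: complexI; rewrite -!norm_cmod normrN. Qed.

Lemma cmod0 : cmod 0 = 0. Proof. exact: Normc.normc0. Qed.

Lemma cmod1 : cmod 1 = 1. Proof. exact: Normc.normc1. Qed.

Lemma cmodV z : cmod z^-1 = (cmod z)^-1.
Proof. exact: Normc.normcV. Qed.

Lemma cmodX z n : cmod (z ^+ n) = cmod z ^+ n.
Proof. by elim: n => [|n IH]; rewrite ?expr0 ?cmod1// !exprS cmodM IH. Qed.

Lemma cmodBC z w : cmod (z - w) = cmod (w - z).
Proof. by rewrite -cmodN opprB. Qed.

Lemma cmodB z w : cmod (z - w) <= cmod z + cmod w.
Proof. by rewrite -[cmod w]cmodN cmodD. Qed.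

Lemma cmod_eq0 z : (cmod z == 0) = (z == 0).
Proof.
by apply/eqP/eqP => [|->]; [exact: Normc.eq0_normc|exact: cmod0].
Qed.

Lemma cmod_gt0 z : (0 < cmod z) = (z != 0).
Proof. by rewrite lt_neqAle cmod_ge0 andbT eq_sym cmod_eq0. Qed.

Lemma cmod_real (x : R) : cmod x%:C%C = `|x|.
Proof. by rewrite /cmod /= expr0n /= addr0 sqrtr_sqr. Qed.

Lemma cmod_nat n : cmod n%:R = n%:R.
Proof.
by apply: complexI; rewrite -norm_cmod normr_nat rmorph_nat.
Qed.

Lemma cmod_sum I (r : seq I) (P : pred I) (F : I -> R[i]) :
  cmod (\sum_(i <- r | P i) F i) <= \sum_(i <- r | P i) cmod (F i).
Proof.
elim/big_ind2: _ => [|a b c d H1 H2|//]; first by rewrite cmod0.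
by apply: le_trans (cmodD _ _) _; exact: lerD.
Qed.

Lemma cmod_sum_ord n (F : 'I_n -> R[i]) (B : R) :
  (forall i, cmod (F i) <= B) -> cmod (\sum_(i < n) F i) <= n%:R * B.
Proof.
move=> H; apply: le_trans (cmod_sum _ _ _) _.
apply: le_trans (ler_sum _ (fun i _ => H i)) _.
by rewrite sumr_const card_ord mulr_natl.
Qed.

End ComplexModulus.

(** * Goursat's bisection for trapezoid sums *)

Section Goursat.
Context {R : realType}.
Local Notation C := R[i].

(** Complex differentiability at one point, with no continuity of the
    derivative. *)
Definition cdiff (h : C -> C) (t : C) := exists b : C, forall e : R, 0 < e ->
  exists2 d : R, 0 < d & forall s, cmod (s - t) < d ->
    cmod (h s - h t - b * (s - t)) <= e * cmod (s - t).

(** The trapezoid approximation of the integral of h along the segment from a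
    to b. *)
Definition trap (h : C -> C) (a b : C) : C := (h a + h b) / 2 * (b - a).

Implicit Types P : nat -> nat -> C.

Definition cell h P i j : C :=
  trap h (P i j) (P i.+1 j) + trap h (P i.+1 j) (P i.+1 j.+1)
  - trap h (P i j.+1) (P i.+1 j.+1) - trap h (P i j) (P i j.+1).

Definition csum h P M i j : C :=
  \sum_(k < M) \sum_(l < M) cell h P (i + k) (j + l).

(** Every inner edge belongs to two cells, with opposite orientations. *)
Lemma csum_boundary h P M i j : csum h P M i j =
  \sum_(k < M) (trap h (P (i + k)%N j) (P (i + k).+1 j)
              - trap h (P (i + k)%N (j + M)%N) (P (i + k).+1 (j + M)%N))
  + \sum_(l < M) (trap h (P (i + M)%N (j + l)%N) (P (i + M)%N (j + l).+1)
              - trap h (P i (j + l)%N) (P i (j + l).+1)).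
Proof.
rewrite /csum.
pose H k l := trap h (P (i + k)%N (j + l)%N) (P (i + k).+1 (j + l)%N).
pose V k l := trap h (P (i + k)%N (j + l)%N) (P (i + k)%N (j + l).+1).
have tel (F : nat -> C) : \sum_(k < M) (F k.+1 - F k) = F M - F 0%N.
  by rewrite -(telescope_sumr F (leq0n M)) big_mkord.
transitivity (\sum_(k < M) \sum_(l < M) ((- H k l.+1 - - H k l) + (V k.+1 l - V k l))).
  apply: eq_bigr => k _; apply: eq_bigr => l _.
  by rewrite /cell /H /V !addnS; ring.
under eq_bigr do rewrite big_split /=.
rewrite big_split /=; congr (_ + _).
  apply: eq_bigr => k _; rewrite (tel (fun l => - H k l)) /H addn0.
  by ring.
rewrite exchange_big /=; apply: eq_bigr => l _.
by rewrite (tel (fun k => V k l)) /V addn0.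
Qed.

Lemma csum_split h P M i j : csum h P (M + M) i j =
  csum h P M i j + csum h P M i (j + M) +
  (csum h P M (i + M) j + csum h P M (i + M) (j + M)).
Proof.
rewrite /csum big_split_ord /=; congr (_ + _); rewrite -big_split /=;
  apply: eq_bigr => k _; rewrite big_split_ord /=; congr (_ + _);
  apply: eq_bigr => l _; by rewrite ?addnA.
Qed.

(** On an affine function the trapezoid rule is an exact increment of a
    primitive, so it sums to 0 around each cell. *)
Lemma csum_affine h h' (a b t0 : C) P M i j :
  (forall t, h' t = h t - a - b * (t - t0)) -> csum h' P M i j = csum h P M i j.
Proof.
move=> E; apply: eq_bigr => k _; apply: eq_bigr => l _.
by rewrite /cell /trap !E; field.
Qed.

Lemma in_range a M p : (a <= p < a + M)%N ->
  (a <= p <= a + M)%N /\ (a <= p.+1 <= a + M)%N.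
Proof. by lia. Qed.

Lemma csum_le h P M i j (B : R) :
  (forall p q, (i <= p < i + M)%N -> (j <= q <= j + M)%N ->
     cmod (trap h (P p q) (P p.+1 q)) <= B) ->
  (forall p q, (i <= p <= i + M)%N -> (j <= q < j + M)%N ->
     cmod (trap h (P p q) (P p q.+1)) <= B) ->
  cmod (csum h P M i j) <= 4 * M%:R * B.
Proof.
move=> H1 H2; rewrite csum_boundary.
have -> : 4 * M%:R * B = M%:R * (B + B) + M%:R * (B + B) by ring.
apply: le_trans (cmodD _ _) _; apply: lerD; apply: cmod_sum_ord => k;
  (apply: le_trans (cmodB _ _) _); apply: lerD; (apply: H1 || apply: H2);
  have := ltn_ord k; lia.
Qed.

(** The limit point of one coordinate of a nested sequence of dyadic cells. *)
Lemma nested_dyadic (u : nat -> nat) : u 0%N = 0%N ->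
  (forall m, (u m).*2 <= u m.+1 <= (u m).*2.+1)%N ->
  exists x : R, forall m, (u m)%:R / 2 ^+ m <= x <= (u m).+1%:R / 2 ^+ m.
Proof.
move=> u0 uS.
have p2 m : (0 : R) < 2 ^+ m by rewrite exprn_gt0.
have up m k : (u m)%:R / 2 ^+ m <= (u (m + k)%N)%:R / 2 ^+ (m + k) :> R.
  elim: k => [|k IH]; first by rewrite addn0.
  apply: le_trans IH _; rewrite addnS exprS invfM mulrA.
  rewrite ler_pM2r ?invr_gt0// ler_pdivlMr// -natrM ler_nat.
  by have := uS (m + k)%N; lia.
have dn m k : (u (m + k)%N).+1%:R / 2 ^+ (m + k) <= (u m).+1%:R / 2 ^+ m :> R.
  elim: k => [|k IH]; first by rewrite addn0.
  apply: le_trans IH; rewrite addnS exprS invfM mulrA.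
  rewrite ler_pM2r ?invr_gt0// ler_pdivrMr// -natrM ler_nat.
  by have := uS (m + k)%N; lia.
have ud m k : (u m)%:R / 2 ^+ m <= (u k).+1%:R / 2 ^+ k :> R.
  apply: le_trans (up m k) _; apply: le_trans (dn k m); rewrite addnC.
  by rewrite ler_pM2r ?invr_gt0// ler_nat.
pose E : set R := [set (u m)%:R / 2 ^+ m | m in [set: nat]].
exists (sup E) => m; apply/andP; split.
  apply: ub_le_sup; last by exists m.
  by exists ((u 0%N).+1%:R / 2 ^+ 0) => _ [k _ <-]; exact: ud.
apply: ge_sup; first by exists ((u 0%N)%:R / 2 ^+ 0), 0%N.
by move=> _ [k _ <-]; exact: ud.
Qed.

Context (h : C -> C) (G : R -> R -> C) (L : R).

Definition grid n i j : C := G (i%:R / 2 ^+ n) (j%:R / 2 ^+ n).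

(** The cell (i, j) of level m, subdivided l more times. *)
Definition subsum m l i j := csum h (grid (m + l)) (2 ^ l) (i * 2 ^ l) (j * 2 ^ l).

Lemma subsumS m l i j : subsum m l.+1 i j =
  subsum m.+1 l i.*2 j.*2 + subsum m.+1 l i.*2 j.*2.+1 +
  (subsum m.+1 l i.*2.+1 j.*2 + subsum m.+1 l i.*2.+1 j.*2.+1).
Proof.
rewrite /subsum addSnnS expnS mul2n -addnn csum_split.
have e k : (k * (2 ^ l + 2 ^ l) = k.*2 * 2 ^ l)%N by lia.
have e' k : (k * (2 ^ l + 2 ^ l) + 2 ^ l = k.*2.+1 * 2 ^ l)%N by lia.
by rewrite !e' !e.
Qed.

Hypothesis L_ge0 : 0 <= L.
Hypothesis GL : forall x y x' y' : R,
  0 <= x <= 1 -> 0 <= y <= 1 -> 0 <= x' <= 1 -> 0 <= y' <= 1 ->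
  cmod (G x y - G x' y') <= L * (`|x - x'| + `|y - y'|).
Hypothesis dG : forall x y : R, 0 <= x <= 1 -> 0 <= y <= 1 -> cdiff h (G x y).

(** Failing to be eventually at most c / 4^m is inherited by one of the four
    children, since the sums over the children add up to the sum over the cell.
    This uses upper limits only: the sums need not be known to converge. *)
Theorem goursat (c : R) : 0 < c ->
  exists N, forall l, (N <= l)%N -> cmod (subsum 0 l 0 0) <= c.
Proof.
move=> c0; apply: contrapT => notc.
have p2 m : (0 : R) < 2 ^+ m by rewrite exprn_gt0.
pose bad m (p : nat * nat) := forall N, exists2 l, (N <= l)%N &
  c / 4 ^+ m < cmod (subsum m l p.1 p.2).
pose child (p q : nat * nat) :=
  (p.1.*2 <= q.1 <= p.1.*2.+1)%N && (p.2.*2 <= q.2 <= p.2.*2.+1)%N.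
have bad0 : bad 0%N (0, 0)%N.
  move=> N; apply: contrapT => H; apply: notc; exists N => l Nl.
  rewrite leNgt; apply/negP => Hc; apply: H; exists l => //.
  by rewrite expr0 divr1.
have step (mp : nat * (nat * nat)) : exists q, bad mp.1 mp.2 ->
    child mp.2 q /\ bad mp.1.+1 q.
  case: mp => m [i j] /=.
  have [B|nB] := pselect (bad m (i, j)); last by exists (0, 0)%N.
  apply: contrapT => nq.
  have good q : child (i, j) q -> exists N, forall l, (N <= l)%N ->
      cmod (subsum m.+1 l q.1 q.2) <= c / 4 ^+ m.+1.
    move=> cq; apply: contrapT => nN; apply: nq; exists q => _; split => // N.
    apply: contrapT => H; apply: nN; exists N => l Nl; rewrite leNgt.
    by apply/negP => Hc; apply: H; exists l.
  have [|N1 H1] := good (i.*2, j.*2); first by rewrite /child /=; lia.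
  have [|N2 H2] := good (i.*2, j.*2.+1); first by rewrite /child /=; lia.
  have [|N3 H3] := good (i.*2.+1, j.*2); first by rewrite /child /=; lia.
  have [|N4 H4] := good (i.*2.+1, j.*2.+1); first by rewrite /child /=; lia.
  have [[|l] Hl] := B (N1 + N2 + N3 + N4).+1; first by lia.
  rewrite subsumS /= => /lt_geF /negP; apply.
  have -> : c / 4 ^+ m = c / 4 ^+ m.+1 + c / 4 ^+ m.+1 + (c / 4 ^+ m.+1 + c / 4 ^+ m.+1).
    rewrite exprS; field; exact: expf_neq0.
  apply: le_trans (cmodD _ _) _; apply: lerD;
    (apply: le_trans (cmodD _ _) _); apply: lerD.
  - by apply: H1; lia.
  - by apply: H2; lia.
  - by apply: H3; lia.
  - by apply: H4; lia.
have [nx Hnx] := choice step.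
pose fix w m : nat * nat := if m is k.+1 then nx (k, w k) else (0, 0)%N.
have wbad m : bad m (w m).
  by elim: m => [//|m IH]; have [] := Hnx (m, w m) IH.
have wch m : child (w m) (w m.+1).
  by have [] := Hnx (m, w m) (wbad m).
have [x Hx] : exists x : R, forall m, ((w m).1)%:R / 2 ^+ m <= x <= ((w m).1).+1%:R / 2 ^+ m.
  by apply: (nested_dyadic (u := fun m => (w m).1)) => // m; case/andP: (wch m).
have [y Hy] : exists y : R, forall m, ((w m).2)%:R / 2 ^+ m <= y <= ((w m).2).+1%:R / 2 ^+ m.
  by apply: (nested_dyadic (u := fun m => (w m).2)) => // m; case/andP: (wch m).
have wlt m : ((w m).1 < 2 ^ m)%N && ((w m).2 < 2 ^ m)%N.
  elim: m => [//|m IH]; have := wch m; rewrite /child expnS.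
  by move: (w m) (w m.+1) IH => [a b] [a' b'] /=; lia.
have x01 : 0 <= x <= 1 by have := Hx 0%N; rewrite expr0 !divr1.
have y01 : 0 <= y <= 1 by have := Hy 0%N; rewrite expr0 !divr1.
have [b hb] := dG x01 y01.
(* A cell of level m has diameter at most 2 L / 2^m and its boundary polygon
   4 * 2^l edges of length at most L / 2^(m + l): the error term contributes
   at most 8 L^2 e / 4^m. *)
pose e := c / (8 * L ^+ 2 + 1).
have Lp : 0 < 8 * L ^+ 2 + 1 by nra.
have e0 : 0 < e by rewrite divr_gt0.
have [d d0 Hd] := hb e e0.
(* A level at which the chosen cell lies in the disc where h is e-close to
   affine. *)
have [m Hm] : exists m, L * 2 / 2 ^+ m < d.
  have [k Hk] : exists k : nat, L * 2 / d < k%:R.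
    exists (Num.bound (L * 2 / d)).
    have := archi_boundP (x := L * 2 / d); apply.
    by rewrite divr_ge0 ?mulr_ge0// ltW.
  exists k; rewrite ltr_pdivrMr// [d * _]mulrC -ltr_pdivrMr//; apply: lt_le_trans Hk _.
  by rewrite -natrX ler_nat ltnW// ltn_expl.
have [l _] := wbad m 0%N; move=> /lt_geF /negP; apply.
set t := G x y in hb Hd.
pose r s := h s - h t - b * (s - t).
rewrite /subsum -(@csum_affine h r (h t) b t)//.
set i := (w m).1; set j := (w m).2.
have P2 : 2 ^+ (m + l) = 2 ^+ m * 2 ^+ l :> R by rewrite exprD.
have near01 (u : nat) (p : nat) (z : R) : (u < 2 ^ m)%N ->
   u%:R / 2 ^+ m <= z <= u.+1%:R / 2 ^+ m ->
   (u * 2 ^ l <= p <= u * 2 ^ l + 2 ^ l)%N ->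
   0 <= (p%:R / 2 ^+ (m + l) : R) <= 1 /\ `|p%:R / 2 ^+ (m + l) - z| <= 1 / 2 ^+ m.
  move=> um /andP[z1 z2] /andP[p1 p2'].
  have E : p%:R / 2 ^+ (m + l) = p%:R / 2 ^+ l / 2 ^+ m :> R.
    by rewrite P2; field; rewrite !expf_neq0.
  have q1 : u%:R / 2 ^+ m <= p%:R / 2 ^+ (m + l) :> R.
    rewrite E ler_pM2r ?invr_gt0//.
    by rewrite ler_pdivlMr// -natrX -natrM ler_nat.
  have q2 : p%:R / 2 ^+ (m + l) <= u.+1%:R / 2 ^+ m :> R.
    rewrite E ler_pM2r ?invr_gt0//.
    by rewrite ler_pdivrMr// -natrX -natrM ler_nat mulSn addnC.
  split.
    rewrite divr_ge0 ?ler0n ?exprn_ge0//=.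
    by apply: le_trans q2 _; rewrite ler_pdivrMr// mul1r -natrX ler_nat.
  move: q2 z2; rewrite -[u.+1%:R]natr1 mulrDl => q2 z2.
  by rewrite ler_norml; apply/andP; split; lra.
have /andP[i2 j2] := wlt m.
have ib (p q : nat) : (i * 2 ^ l <= p <= i * 2 ^ l + 2 ^ l)%N ->
    (j * 2 ^ l <= q <= j * 2 ^ l + 2 ^ l)%N ->
    cmod (r (grid (m + l) p q)) <= e * (L * 2 / 2 ^+ m).
  move=> pi qj; have [p01 pd] := near01 _ _ _ i2 (Hx m) pi.
  have [q01 qd] := near01 _ _ _ j2 (Hy m) qj.
  have D : cmod (grid (m + l) p q - t) <= L * 2 / 2 ^+ m.
    apply: le_trans (GL p01 q01 x01 y01) _.
    by rewrite -mulrA ler_wpM2l//; lra.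
  apply: le_trans (Hd _ (le_lt_trans D Hm)) _.
  by rewrite ler_wpM2l// ltW.
have edge (a a' : C) (K K' : R) : cmod (r a) <= K -> cmod (r a') <= K ->
    cmod (a' - a) <= K' -> cmod (trap r a a') <= K * K'.
  move=> ra ra' aa'; rewrite /trap cmodM cmodM cmodV (cmod_nat 2).
  apply: ler_pM => //; [by rewrite mulr_ge0 ?cmod_ge0| exact: cmod_ge0|].
  by rewrite ler_pdivrMr//; have := cmodD (r a) (r a'); lra.
have -> : c / 4 ^+ m = (8 * L ^+ 2 + 1) * e / 4 ^+ m.
  by rewrite /e mulrCA divff ?gt_eqF// mulr1.
apply: (@le_trans _ _ (4 * (2 ^ l)%N%:R * (e * (L * 2 / 2 ^+ m) * (L * (1 / 2 ^+ (m + l)))))).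
  apply: csum_le => p q Hp Hq.
  - have [Hp0 Hp1] := in_range Hp; have Hq0 := Hq.
    apply: edge; [exact: ib|exact: ib|].
    have [p01 _] := near01 _ p _ i2 (Hx m) Hp0.
    have [p01' _] := near01 _ p.+1 _ i2 (Hx m) Hp1.
    have [q01 _] := near01 _ q _ j2 (Hy m) Hq0.
    apply: le_trans (GL p01' q01 p01 q01) _; rewrite ler_wpM2l//.
    rewrite subrr normr0 addr0 -mulrBl -[p.+1%:R]natr1 addrAC subrr add0r.
    by rewrite ger0_norm// divr_ge0// ltW.
  - have [Hq0 Hq1] := in_range Hq; have Hp0 := Hp.
    apply: edge; [exact: ib|exact: ib|].
    have [p01 _] := near01 _ p _ i2 (Hx m) Hp0.
    have [q01 _] := near01 _ q _ j2 (Hy m) Hq0.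
    have [q01' _] := near01 _ q.+1 _ j2 (Hy m) Hq1.
    apply: le_trans (GL p01 q01' p01 q01) _; rewrite ler_wpM2l//.
    rewrite subrr normr0 add0r -mulrBl -[q.+1%:R]natr1 addrAC subrr add0r.
    by rewrite ger0_norm// divr_ge0// ltW.
have -> : 4 * (2 ^ l)%N%:R * (e * (L * 2 / 2 ^+ m) * (L * (1 / 2 ^+ (m + l))))
   = 8 * L ^+ 2 * e / 4 ^+ m.
  have E4 : 4 ^+ m = 2 ^+ m * 2 ^+ m :> R by rewrite -exprMn -natrM.
  by rewrite natrX P2 E4; field; rewrite !expf_neq0.
rewrite ler_pM2r ?invr_gt0 ?exprn_gt0// ler_pM2r//; lra.
Qed.

End Goursat.

(** * Roots of unity and difference quotients *)

Section Circle.
Context {R : realType}.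
Local Notation C := R[i].

(** The angle is measured in turns, so that the circle is parametrized by the
    unit interval. *)
Definition cis (x : R) : C := Complex (cos (2 * pi * x)) (sin (2 * pi * x)).

Lemma cisD x y : cis (x + y) = cis x * cis y.
Proof.
by rewrite /cis mulrDr cosD sinD [X in Complex _ X]addrC.
Qed.

Lemma cis0 : cis 0 = 1.
Proof. by rewrite /cis mulr0 cos0 sin0. Qed.

Lemma cis1 : cis 1 = 1.
Proof. by rewrite /cis mulr1 mulr_natl cos2pi sin2pi. Qed.

Lemma cis_half : cis 2^-1 = -1.
Proof.
rewrite /cis mulrAC divff// mul1r cospi sinpi.
by apply/eqP; rewrite eq_complex /= oppr0 !eqxx.
Qed.

Lemma cmod_cis x : cmod (cis x) = 1.
Proof. by rewrite /cmod /cis /= cos2Dsin2 sqrtr1. Qed.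

Lemma cis_neq0 x : cis x != 0.
Proof. by rewrite -cmod_gt0 cmod_cis. Qed.

Lemma cisMn x n : cis (x *+ n) = cis x ^+ n.
Proof. by elim: n => [|n IH]; rewrite ?mulr0n ?cis0// mulrS cisD IH exprS. Qed.

Lemma lipschitz_of_derive_le1 (f df : R -> R) : (forall x : R, is_derive x 1 f (df x)) ->
  (forall x, `|df x| <= 1) -> forall x y, `|f x - f y| <= `|x - y|.
Proof.
move=> fd fb; suff H x y : x <= y -> `|f y - f x| <= `|y - x|.
  move=> x y; have [xy|/ltW yx] := leP x y; last exact: H.
  by rewrite distrC [leRHS]distrC; exact: H.
move=> xy; have [|c _ ->] := @MVT_segment R f df x y xy (fun x _ => fd x).
  by apply: derivable_within_continuous => t _; apply: ex_derive.
by rewrite normrM ler_piMl.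
Qed.

Lemma cmod_le_ReIm (z : C) : cmod z <= `|complex.Re z| + `|complex.Im z|.
Proof.
case: z => a b /=; rewrite /cmod /=.
have -> : `|a| + `|b| = Num.sqrt ((`|a| + `|b|) ^+ 2).
  by rewrite sqrtr_sqr [RHS]ger0_norm ?addr_ge0.
rewrite ler_sqrt ?sqr_ge0// sqrrD !real_normK ?num_real// addrAC lerDl.
by rewrite mulrn_wge0// mulr_ge0.
Qed.

Lemma cis_lip x y : cmod (cis x - cis y) <= 4 * pi * `|x - y|.
Proof.
apply: le_trans (cmod_le_ReIm _) _ => /=.
have E : `|2 * pi * x - 2 * pi * y| = 2 * pi * `|x - y|.
  by rewrite -mulrBr normrM ger0_norm// mulr_ge0// pi_ge0.
have -> : 4 * pi * `|x - y| = 2 * pi * `|x - y| + 2 * pi * `|x - y| by ring.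
rewrite -E; apply: lerD.
  apply: (@lipschitz_of_derive_le1 cos (fun x => - sin x)) => t.
  by rewrite normrN ler_norml sin_geN1 sin_le1.
apply: (@lipschitz_of_derive_le1 sin cos) => t.
by rewrite ler_norml cos_geN1 cos_le1.
Qed.

(** Quotient rule for g(s) - g(z) over s - z, away from the pole. *)
Lemma cdiff_quot (g : C -> C) (z t : C) : cdiff g t -> t != z ->
  cdiff (fun s => (g s - g z) / (s - z)) t.
Proof.
move=> [b gb] tz.
have tz0 : t - z != 0 by rewrite subr_eq0.
set q := (g t - g z) / (t - z).
exists ((b - q) / (t - z)) => e e0.
set m := cmod (t - z); have m0 : 0 < m by rewrite cmod_gt0.
set B := cmod (b - q); have B0 : 0 <= B by exact: cmod_ge0.
have [d d0 Hd] := gb (e * m / 4) ltac:(by rewrite divr_gt0// mulr_gt0).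
have B1 : 0 < 4 * (B + 1) by lra.
exists (Num.min d (Num.min (m / 2) (e * m ^+ 2 / (4 * (B + 1))))).
  by rewrite !lt_min d0 /= !divr_gt0// mulr_gt0// exprn_gt0.
move=> s; rewrite !lt_min => /and3P[sd sm se].
have sz : m / 2 <= cmod (s - z).
  have := cmodB (s - z) (s - t).
  by rewrite (_ : s - z - (s - t) = t - z) -/m; [lra|ring].
have sz1 : 0 < cmod (s - z) by lra.
have sz0 : s - z != 0 by rewrite -cmod_gt0.
set r := g s - g t - b * (s - t).
have Hr : cmod r <= e * m / 4 * cmod (s - t) by exact: Hd.
have -> : (g s - g z) / (s - z) - q - (b - q) / (t - z) * (s - t) =
   (r - (b - q) * (s - t) ^+ 2 / (t - z)) / (s - z).
  by rewrite /r /q; field; rewrite ?tz0 ?sz0.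
rewrite cmodM cmodV ler_pdivrMr//.
apply: le_trans (cmodB _ _) _.
rewrite 2!cmodM cmodX cmodV -/B -/m.
set u := cmod (s - t) in sd sm se Hr *.
have u0 : 0 <= u by exact: cmod_ge0.
have k1 : B * u ^+ 2 / m <= e * m / 4 * u.
  rewrite ler_pdivrMr//.
  have : u * (4 * (B + 1)) <= e * m ^+ 2 by rewrite -ler_pdivlMr// ltW.
  move=> H.
  have H2 : u * (u * (4 * (B + 1))) <= u * (e * m ^+ 2) by rewrite ler_wpM2l.
  have H3 : 0 <= u * u by rewrite mulr_ge0.
  by nra.
have k2 : e * u * (m / 2) <= e * u * cmod (s - z).
  by rewrite ler_wpM2l// mulr_ge0// ltW.
by nra.
Qed.

Lemma cdiff_bounded (g : C -> C) (z : C) : cdiff g z ->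
  exists M : R, exists2 d : R, 0 < d & forall s, cmod (s - z) < d ->
    cmod ((g s - g z) / (s - z)) <= M.
Proof.
move=> [b gb]; have [d d0 Hd] := gb 1 ltr01.
exists (1 + cmod b); exists d => // s /Hd H.
have [->|sz] := eqVneq s z.
  by rewrite subrr mul0r cmod0 addr_ge0// cmod_ge0.
have sz0 : 0 < cmod (s - z) by rewrite cmod_gt0 subr_eq0.
rewrite cmodM cmodV ler_pdivrMr// mulrDl -cmodM.
apply: le_trans (lerD H (lexx _)).
by apply: le_trans (cmodD _ _); rewrite subrK.
Qed.

Variable rho : R.
Hypothesis rho_gt0 : 0 < rho.

Definition node n k : C := rho%:C%C * cis (k%:R / 2 ^+ n).

Lemma rhoC_neq0 : rho%:C%C != 0 :> C.
Proof. by rewrite -cmod_gt0 cmod_real normr_gt0 gt_eqF. Qed.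

Lemma node_neq0 n k : node n k != 0.
Proof. by rewrite mulf_neq0 ?cis_neq0 ?rhoC_neq0. Qed.

Lemma cmod_node n k : cmod (node n k) = rho.
Proof. by rewrite cmodM cmod_real cmod_cis mulr1 gtr0_norm. Qed.

Lemma cisX n k : cis (k%:R / 2 ^+ n) = cis (2 ^- n) ^+ k.
Proof. by rewrite -cisMn mulr_natl. Qed.

Lemma cis_unity n : cis (2 ^- n) ^+ (2 ^ n) = 1.
Proof. by rewrite -cisX natrX divff ?expf_neq0// cis1. Qed.

Lemma cis_unity_half n : cis (2 ^- n.+1) ^+ (2 ^ n) = -1.
Proof.
by rewrite -cisX natrX exprS invfM mulrCA divff ?expf_neq0// mulr1 cis_half.
Qed.

(** The order of the root divides 2^n but not 2^(n-1), since the power 2^(n-1)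
    is -1. *)
Lemma cis_primitive n m : (0 < m < 2 ^ n)%N -> cis (2 ^- n) ^+ m != 1.
Proof.
case: n => [|n]; first by lia.
move=> /andP[m0 mn]; apply/eqP => w1.
have [k pk] := prim_order_exists m0 w1.
move=> km; have := prim_order_dvd pk (2 ^ n.+1).
rewrite cis_unity eqxx => /(dvdn_pfactor _ _ (erefl : prime 2)) [j jn kE].
have : j != n.+1.
  apply/eqP => jE; move: km; rewrite kE jE => /(dvdn_leq m0); lia.
move=> jn'; have jn2 : (j <= n)%N by lia.
have := prim_order_dvd pk (2 ^ n); rewrite kE dvdn_exp2l// cis_unity_half.
by rewrite -subr_eq0 -opprD oppr_eq0 -mulr2n (pnatr_eq0 _ 2).
Qed.

Lemma nodeX n k : node n k ^+ (2 ^ n) = rho%:C%C ^+ (2 ^ n).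
Proof. by rewrite exprMn cisX exprAC cis_unity expr1n mulr1. Qed.

(** Truncated Cauchy kernel: a polynomial in u that differs from 1 / (1 - u)
    by the factor 1 - u^N. *)
Definition kern N (u : C) : C := \sum_(m < N) u ^+ m.

(** Only the constant term of the kernel survives the summation over the
    nodes, by orthogonality of the powers of a primitive root. *)
Lemma kern_node n (z : C) : \sum_(k < 2 ^ n) kern (2 ^ n) (z / node n k) = (2 ^ n)%:R.
Proof.
rewrite exchange_big /=.
have n0 : (0 < 2 ^ n)%N by rewrite expn_gt0.
rewrite (bigD1 (Ordinal n0))//= [X in _ + X]big1 ?addr0.
  by rewrite (eq_bigr (fun=> 1)) ?sumr_const ?card_ord// => k _; rewrite expr0.
move=> m m0.
have mm : (0 < m < 2 ^ n)%N.
  by rewrite ltn_ord andbT lt0n; move: m0; apply: contra => /eqP m0; exact/eqP/val_inj.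
set v := cis (2 ^- n) ^- m.
have v1 : v != 1 by rewrite invr_eq1 cis_primitive.
have vN : v ^+ (2 ^ n) = 1 by rewrite exprVn exprAC cis_unity expr1n invr1.
transitivity (\sum_(k < 2 ^ n) (z / rho%:C%C) ^+ m * v ^+ k).
  apply: eq_bigr => k _; rewrite /node cisX invfM mulrA exprMn; congr (_ * _).
  by rewrite /v !exprVn exprAC.
rewrite -mulr_sumr; have := subrX1 v (2 ^ n); rewrite vN subrr => /esym/eqP.
by rewrite mulf_eq0 subr_eq0 (negPf v1) /= => /eqP ->; rewrite mulr0.
Qed.

Lemma kern_geom N (u : C) : (1 - u) * kern N u = 1 - u ^+ N.
Proof.
by rewrite -opprB mulNr -subrX1 opprB.
Qed.

End Circle.

(** * The discrete Cauchy formula *)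

Section Cauchy.
Context {R : realType}.
Local Notation C := R[i].

(** With w the root, the 2^n / 4 chords between consecutive powers of w^2 lead
    from 1 to -1, so their total length is at least 2; each is |w - 1/w|. *)
Lemma chord_lower_bound n : (2 <= n)%N ->
  8 <= 2 ^+ n * cmod (cis (2 ^- n) - (cis (2 ^- n))^-1 : C).
Proof.
case: n => [//|[//|n _]].
set w := cis (2 ^- n.+2) : C.
have w1 : cmod w = 1 by rewrite cmod_cis.
have w0 : w != 0 by exact: cis_neq0.
have -> : w - w^-1 = (w ^+ 2 - 1) / w by field.
rewrite cmodM cmodV w1 invr1 mulr1.
have H : (w ^+ 2) ^+ (2 ^ n) = -1 by rewrite -exprM -expnS cis_unity_half.
have := subrX1 (w ^+ 2) (2 ^ n); rewrite H => /(congr1 (@cmod R)).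
rewrite cmodM -opprD cmodN (_ : 1 + 1 = 2%:R)// cmod_nat => E.
have B : cmod (\sum_(i < 2 ^ n) (w ^+ 2) ^+ i) <= (2 ^ n)%N%:R.
  have := @cmod_sum_ord R (2 ^ n) (fun i => (w ^+ 2) ^+ i) 1; rewrite mulr1; apply.
  by move=> i; rewrite !cmodX w1 !expr1n.
have := ler_wpM2l (cmod_ge0 (w ^+ 2 - 1)) B; rewrite -E natrX => H2.
by rewrite (exprS 2 n.+1) (exprS 2 n); lra.
Qed.

(** Summation by parts: in a closed polygon each vertex contributes h(t_k)
    times half of t_(k+1) - t_(k-1), here a fixed multiple of t_k. *)
Lemma closed_polygon_sum (h : C -> C) (t : nat -> C) (w : C) N : w != 0 ->
  (forall k, t k.+1 = w * t k) -> t N = t 0%N ->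
  \sum_(k < N) trap h (t k) (t k.+1) =
  (w - w^-1) / 2 * \sum_(k < N) h (t k) * t k.
Proof.
move=> w0 tS tN.
pose u k := h (t k) * (t k - w^-1 * t k).
have shift : \sum_(k < N) u k.+1 = \sum_(k < N) u k.
  apply/eqP; rewrite -subr_eq0 -sumrB -(big_mkord xpredT (fun k => u k.+1 - u k)).
  by rewrite telescope_sumr// /u tN subrr.
transitivity (\sum_(k < N) (h (t k) * (w * t k - t k) / 2 + u k.+1 / 2)).
  by apply: eq_bigr => k _; rewrite /trap /u tS; field.
rewrite big_split /= -[X in _ + X]mulr_suml shift mulr_suml -big_split mulr_sumr.
by apply: eq_bigr => k _; rewrite /u /=; field.
Qed.

Variable rho : R.
Hypothesis rho01 : 0 < rho < 1.
Let rho_gt0 : 0 < rho. Proof. by case/andP: rho01. Qed.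
Local Notation node := (node rho).

(** Cauchy's theorem for the difference quotient h of g at z. The circle is
    contracted linearly towards z, down to the scale del. In the annulus h is
    differentiable, so the outer and inner sums agree up to a small error; the
    inner sum is small because h is bounded near z and the inner curve is
    short. *)
Theorem cauchy_circle (g : C -> C) (z : C) :
  (forall t, cmod t < 1 -> cdiff g t) -> cmod z < rho ->
  forall c : R, 0 < c -> exists n0, forall n, (n0 <= n)%N ->
    cmod ((2 ^ n)%N%:R^-1 *
      \sum_(k < 2 ^ n) (g (node n k) - g z) / (node n k - z) * node n k) <= c.
Proof.
move=> gd zr c c0.
have rho1 : rho < 1 by case/andP: rho01.
pose h s := (g s - g z) / (s - z).
(* Near z the integrand is only known to be bounded, so the inner
   curve has to be short, and its scale del small. *)
have [M [d d0 Hd]] := cdiff_bounded (gd z (lt_trans zr rho1)).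
have M0 : 0 <= M by apply: le_trans (Hd z _); rewrite ?cmod_ge0// subrr cmod0.
pose K := 4 * (pi : R).
have K0 : 0 <= K by rewrite mulr_ge0// pi_ge0.
have MK : 0 < M * K + 1 by rewrite ltr_wpDl// mulr_ge0.
have [del del0 [del1 deld delc]] : exists2 del : R, 0 < del &
    [/\ del <= 1, del <= d / 4 & del <= c / (M * K + 1)].
  exists (Num.min 1 (Num.min (d / 4) (c / (M * K + 1)))).
    by rewrite !lt_min ltr01 !divr_gt0.
  by rewrite !ge_min !lexx /= !orbT.
pose sc (x : R) : R := del + (1 - del) * x.
pose G (x y : R) : C := z + (sc x)%:C%C * (rho%:C%C * cis y - z).
have sc01 (x : R) : 0 <= x <= 1 -> 0 < sc x <= 1.
  by rewrite /sc => /andP[x0 x1]; apply/andP; split; nra.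
have GL (x y x' y' : R) : 0 <= x <= 1 -> 0 <= y <= 1 -> 0 <= x' <= 1 -> 0 <= y' <= 1 ->
    cmod (G x y - G x' y') <= (2 + K) * (`|x - x'| + `|y - y'|).
  move=> x01 y01 x01' y01'.
  have -> : G x y - G x' y' = (sc x - sc x')%:C%C * (rho%:C%C * cis y - z)
      + (sc x')%:C%C * rho%:C%C * (cis y - cis y').
    by rewrite /G rmorphB; ring.
  apply: le_trans (cmodD _ _) _; rewrite !cmodM !cmod_real.
  have /andP[s0 s1] := sc01 _ x01'.
  rewrite (gtr0_norm rho_gt0) (gtr0_norm s0).
  have e1 : `|sc x - sc x'| <= `|x - x'|.
    have -> : sc x - sc x' = (1 - del) * (x - x') by rewrite /sc; ring.
    rewrite normrM ler_piMl// ger0_norm; lra.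
  have e2 : cmod (rho%:C%C * cis y - z) <= 2.
    apply: le_trans (cmodB _ _) _; rewrite cmodM cmod_cis cmod_real gtr0_norm//; lra.
  have e3 := cis_lip y y'; rewrite -/K in e3.
  have f1 : `|sc x - sc x'| * cmod (rho%:C%C * cis y - z) <= `|x - x'| * 2.
    by apply: ler_pM => //; exact: cmod_ge0.
  have f2 : sc x' * rho * cmod (cis y - cis y' : C) <= 1 * (K * `|y - y'|).
    apply: ler_pM => //; [by rewrite mulr_ge0 ?ltW|exact: cmod_ge0|].
    by rewrite mulr_ile1 ?s1 ?(ltW s0) ?(ltW rho_gt0) ?(ltW rho1).
  have := normr_ge0 (x - x'); have := normr_ge0 (y - y').
  by nra.
have zrho y : rho%:C%C * cis y - z != 0.
  rewrite subr_eq0; apply/eqP => E; move: zr; rewrite -E cmodM cmod_cis cmod_real.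
  by rewrite gtr0_norm// mulr1 ltxx.
have dG (x y : R) : 0 <= x <= 1 -> 0 <= y <= 1 -> cdiff h (G x y).
  move=> x01 y01; have /andP[s0 s1] := sc01 _ x01.
  apply: cdiff_quot.
    apply: gd.
    have -> : G x y = (1 - sc x)%:C%C * z + (sc x)%:C%C * (rho%:C%C * cis y).
      by rewrite /G rmorphB rmorph1; ring.
    apply: le_lt_trans (cmodD _ _) _.
    rewrite !cmodM cmod_cis !cmod_real (gtr0_norm rho_gt0) (gtr0_norm s0) mulr1.
    rewrite ger0_norm ?subr_ge0//.
    have : (1 - sc x) * cmod z <= (1 - sc x) * rho by rewrite ler_wpM2l ?subr_ge0 // ltW.
    by lra.
  rewrite -subr_eq0 /G addrAC subrr add0r mulf_neq0//.
  by rewrite -cmod_gt0 cmod_real normr_gt0 gt_eqF.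
have [N0 HN0] := goursat (addr_ge0 (ler0n R 2) K0) GL dG c0.
exists (maxn N0 2) => n; rewrite geq_max => /andP[nN n2].
have := HN0 n nN; rewrite /subsum add0n mul0n csum_boundary.
have p2 : (0 : R) < 2 ^+ n by rewrite exprn_gt0.
have N1 : (0 + 2 ^ n)%N%:R / 2 ^+ n = 1 :> R.
  by rewrite add0n natrX divff// gt_eqF.
have N00 : 0%N%:R / 2 ^+ n = 0 :> R by rewrite mul0r.
(* The two radial sides coincide, since theta = 0 and theta = 1 give the same
   direction, so they cancel. *)
rewrite [X in cmod (X + _)]big1 ?add0r; last first.
  move=> k _; rewrite /grid N1 N00 /G cis0 cis1 subrr//.
rewrite sumrB.
have Gout y : G 1 y = rho%:C%C * cis y.
  by rewrite /G /sc mulr1 [del + _]addrC subrK mul1r addrC subrK.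
have inner : cmod (\sum_(l < 2 ^ n) trap h (grid G n 0 (0 + l)) (grid G n 0 (0 + l).+1)) <= c.
  have dl (p : nat) : cmod (h (grid G n 0 p)) <= M.
    apply: Hd; rewrite /grid N00 /G /sc mulr0 addr0 addrAC subrr add0r.
    rewrite cmodM cmod_real gtr0_norm//.
    have e2 : cmod (rho%:C%C * cis (p%:R / 2 ^+ n) - z) <= 2.
      apply: le_trans (cmodB _ _) _; rewrite cmodM cmod_cis cmod_real gtr0_norm//; lra.
    have := ler_wpM2l (ltW del0) e2; lra.
  apply: (@le_trans _ _ ((2 ^ n)%N%:R * (M * (del * (K / 2 ^+ n))))).
    apply: cmod_sum_ord => k; rewrite /trap 2!cmodM cmodV (cmod_nat 2).
    apply: ler_pM; rewrite ?cmod_ge0//.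
    - by rewrite divr_ge0 ?cmod_ge0.
    - rewrite ler_pdivrMr//; apply: le_trans (cmodD _ _) _.
      by have := dl (0 + k)%N; have := dl (0 + k)%N.+1; lra.
    rewrite /grid N00 /G /sc mulr0 addr0.
    set b := cis _; set a := cis _.
    have -> : z + del%:C%C * (rho%:C%C * b - z) - (z + del%:C%C * (rho%:C%C * a - z))
      = del%:C%C * (rho%:C%C * (b - a)) by ring.
    rewrite !cmodM !cmod_real (gtr0_norm del0) (gtr0_norm rho_gt0) ler_wpM2l ?(ltW del0)//.
    have e3 := @cis_lip R ((0 + k)%N.+1%:R / 2 ^+ n) ((0 + k)%N%:R / 2 ^+ n).
    have dk : `|(0 + k)%N.+1%:R / 2 ^+ n - (0 + k)%N%:R / 2 ^+ n| = 1 / 2 ^+ n :> R.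
      by rewrite add0n -mulrBl -[k.+1%:R]natr1 addrAC subrr add0r gtr0_norm ?divr_gt0.
        rewrite -/a -/b -/K dk div1r in e3.
    apply: le_trans _ e3; rewrite ler_piMl ?cmod_ge0 ?(ltW rho1)//.
  rewrite natrX (_ : _ * _ = M * K * del); last by field; rewrite gt_eqF.
  have : del * (M * K + 1) <= c by rewrite -ler_pdivlMr.
  by have := del0; lra.
pose w : C := cis (2 ^- n).
have tS k : node n k.+1 = w * node n k.
  by rewrite /node !cisX exprS mulrCA.
have tN : node n (2 ^ n) = node n 0.
  by rewrite /node !cisX cis_unity expr0.
have -> : \sum_(l < 2 ^ n) trap h (grid G n (0 + 2 ^ n) (0 + l)) (grid G n (0 + 2 ^ n) (0 + l).+1)
   = \sum_(k < 2 ^ n) trap h (node n k) (node n k.+1).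
  by apply: eq_bigr => k _; rewrite /grid N1 !Gout !add0n.
(* What is left is the outer polygon against the inner one. *)
rewrite (@closed_polygon_sum h (node n) w)// ?cis_neq0//.
set S := \sum_(k < _) h _ * _; set I := \sum_(l < _) _ in inner *.
move=> H.
have T : cmod ((w - w^-1) / 2 * S) <= c + c.
  have := cmodD ((w - w^-1) / 2 * S - I) I; rewrite subrK; lra.
have low := chord_lower_bound n2; rewrite -/w in low.
move: T; rewrite 2!cmodM cmodV (cmod_nat 2) => T.
rewrite cmodM cmodV cmod_nat natrX mulrC ler_pdivrMr//.
have S0 := cmod_ge0 S; have W0 := cmod_ge0 (w - w^-1).
have q1 := ler_wpM2r S0 low.
have q2 := ler_wpM2l (ltW p2) T.
by nra.
Qed.

(** The polynomial of degree less than 2^n that agrees with g at the nodes, in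
    the form of a discrete Cauchy integral. *)
Definition interp (g : C -> C) n (z : C) : C :=
  (2 ^ n)%N%:R^-1 * \sum_(k < 2 ^ n) g (node n k) * kern (2 ^ n) (z / node n k).

(** As the kernels sum to 1 on average, the error is a mean of
    (g(t) - g(z)) kern(z / t), and kern(z / t) (t - z) = t (1 - (z / rho)^N). *)
Theorem interp_cvg (g : C -> C) (z : C) :
  (forall t, cmod t < 1 -> cdiff g t) -> cmod z < rho ->
  forall c : R, 0 < c -> exists n0, forall n, (n0 <= n)%N ->
    cmod (interp g n z - g z) <= c.
Proof.
move=> gd zr c c0.
have [n0 Hn0] := cauchy_circle gd zr (ltac:(by rewrite divr_gt0) : 0 < c / 2).
exists n0 => n /Hn0.
have Nn0 : (2 ^ n)%N%:R != 0 :> C by rewrite pnatr_eq0 -lt0n expn_gt0.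
set q := (z / rho%:C%C) ^+ (2 ^ n).
have -> : interp g n z - g z = (1 - q) * ((2 ^ n)%N%:R^-1 *
      \sum_(k < 2 ^ n) (g (node n k) - g z) / (node n k - z) * node n k).
  have Eg : g z = (2 ^ n)%N%:R^-1 * \sum_(k < 2 ^ n) g z * kern (2 ^ n) (z / node n k).
    by rewrite -mulr_sumr (kern_node rho_gt0) natrX mulrCA mulVf ?mulr1// -natrX.
  rewrite [in LHS]Eg /interp -mulrBr mulrCA; congr (_ * _).
  rewrite -sumrB mulr_sumr; apply: eq_bigr => k _.
  have t0 := node_neq0 rho_gt0 n k.
  have tz : node n k - z != 0.
    rewrite subr_eq0; apply/eqP => E; move: zr.
    by rewrite -E (cmod_node rho_gt0) ltxx.
  have -> : q = (z / node n k) ^+ (2 ^ n).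
    by rewrite /q !exprMn !exprVn nodeX.
  rewrite -kern_geom.
  set kk := kern _ _; move: (g z) => gz.
  by field; rewrite tz t0.
move=> H; rewrite cmodM.
have q1 : cmod (1 - q) <= 2.
  apply: le_trans (cmodB _ _) _; rewrite cmod1 /q cmodX cmodM cmodV cmod_real.
  rewrite gtr0_norm// -[X in _ <= X]/(1 + 1) lerD2l exprn_ile1//.
    by rewrite divr_ge0 ?cmod_ge0 ?ltW.
  by rewrite ler_pdivrMr// mul1r ltW.
apply: (le_trans (ler_pM (cmod_ge0 _) (cmod_ge0 _) q1 H)); lra.
Qed.

End Cauchy.

(** * Topology of complex row vectors *)

(** The complex numbers as an abstract [numClosedFieldType], which is the form
    in which a topology is attached to them. *)
Definition CC (R : realType) : numClosedFieldType := R[i].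
Arguments CC : simpl never.

Section Topology.
Context {R : realType}.
Local Notation C := (CC R).

Definition toC (a : R) : C := a%:C%C.

Lemma normCE (z : C) : `|z| = toC (cmod z).
Proof. exact: norm_cmod. Qed.

Lemma ltCE (a b : R) : (toC a < toC b) = (a < b).
Proof. exact: ltcR. Qed.

Lemma posCE (e : C) : 0 < e -> exists2 k : R, e = toC k & 0 < k.
Proof.
move=> e0; exists (complex.Re e); last first.
  by rewrite -ltCE /toC RRe_real// gtr0_real.
by rewrite /toC RRe_real// gtr0_real.
Qed.

Lemma near_cmod (t0 : C) (e : R) : 0 < e -> \forall t \near t0, cmod (t - t0) < e.
Proof.
move=> e0; apply/nbhs_ballP; exists (toC e) => /=; first by rewrite (ltCE 0).
by move=> t; rewrite /ball /= distrC normCE ltCE.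
Qed.

Lemma cvg_cmod {T : Type} (F : set_system T) {FF : Filter F} (f : T -> C) (l : C) :
  f @ F --> l <-> forall e : R, 0 < e -> \forall t \near F, cmod (f t - l) < e.
Proof.
split=> [fl e e0|H]; first exact: fl (near_cmod l e0).
apply/cvgrPdist_lt => e /posCE[k -> k0].
by apply: filterS (H k k0) => t; rewrite distrC normCE ltCE.
Qed.

Lemma continuous_cmod (T : topologicalType) (f : T -> C) (x : T) :
  {for x, continuous f} <->
  forall e : R, 0 < e -> \forall y \near x, cmod (f y - f x) < e.
Proof. exact: cvg_cmod. Qed.

Lemma unit_discE (z : C) : unit_disc C z <-> cmod z < 1.
Proof. by rewrite /unit_disc /= normCE (ltCE _ 1). Qed.

Lemma continuous_cmodR : continuous (@cmod R : C -> R).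
Proof.
move=> z; apply/(@cvgrPdist_lt _ _ _ _ (nbhs_filter z)) => e e0.
near=> t; have : cmod (t - z) < e by near: t; exact: near_cmod.
apply: le_lt_trans.
have := cmodD (z - t) t; have := cmodD (t - z) z; rewrite !subrK [cmod (z - t)]cmodBC.
by move=> h1 h2; rewrite ler_norml; apply/andP; split; lra.
Unshelve. all: by end_near. Qed.

Lemma closed_cdisc (r : R) : closed [set z : C | cmod z <= r].
Proof.
rewrite (_ : mkset _ = @cmod R @^-1` [set x | x <= r])//.
apply: closed_comp; last exact: closed_le.
by move=> x _; exact: continuous_cmodR.
Qed.

Lemma compact_cdisc (r : R) : compact [set z : C | cmod z <= r].
Proof.
pose f (p : R * R) : C := Complex p.1 p.2.
have cf : continuous f.
  move=> p; apply/continuous_cmod => e e0.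
  have e2 : 0 < e / 2 by rewrite divr_gt0.
  have h1 : \forall q \near p, `|p.1 - q.1| < e / 2.
    exact: (@cvgr_dist_lt _ _ _ (nbhs p) _ fst p.1 cvg_fst _ e2).
  have h2 : \forall q \near p, `|p.2 - q.2| < e / 2.
    exact: (@cvgr_dist_lt _ _ _ (nbhs p) _ snd p.2 cvg_snd _ e2).
  near=> q; apply: le_lt_trans (cmod_le_ReIm _) _.
  rewrite -[_ - _]/(Complex (q.1 - p.1) (q.2 - p.2)) /=.
  have a1 : `|p.1 - q.1| < e / 2 by near: q.
  have a2 : `|p.2 - q.2| < e / 2 by near: q.
  by rewrite distrC [`|q.2 - _|]distrC; lra.
apply: (@subclosed_compact _ _ (f @` (`[- r, r]%classic `*` `[- r, r]%classic))).
- exact: closed_cdisc.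
- apply: continuous_compact; first exact: continuous_subspaceT.
  by apply: compact_setX; exact: segment_compact.
move=> [a b] /= zr; exists (a, b) => //=; rewrite !in_itv /= -!ler_norml.
have ha : `|a| <= cmod (Complex a b).
  by rewrite /cmod /= -[`|a|]sqrtr_sqr ler_sqrt ?lerDl ?sqr_ge0// addr_ge0 ?sqr_ge0.
have hb : `|b| <= cmod (Complex a b).
  by rewrite /cmod /= -[`|b|]sqrtr_sqr ler_sqrt ?lerDr ?sqr_ge0// addr_ge0 ?sqr_ge0.
by rewrite (le_trans ha)// (le_trans hb).
Unshelve. all: by end_near. Qed.

Definition polyball d (r : R) : set 'rV[C]_d := [set x | forall j, cmod (x ord0 j) <= r].
Arguments polyball : clear implicits.

Lemma compact_polyball d r : compact (polyball d r).
Proof.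
have := @rV_compact C d (fun=> [set z | cmod z <= r]) (fun=> @compact_cdisc r).
by [].
Qed.

Lemma polydiscE d (x : 'rV[C]_d) : polydisc C d x <-> forall j, cmod (x ord0 j) < 1.
Proof. by split => H j; apply/unit_discE; exact: H. Qed.

Lemma kern_le N (u : C) (q : R) : q < 1 -> cmod u <= q -> cmod (kern N u) <= (1 - q)^-1.
Proof.
move=> q1 uq; have q0 : 0 <= q by exact: le_trans (cmod_ge0 _) uq.
elim: N => [|N IH]; first by rewrite /kern big_ord0 cmod0 invr_ge0 subr_ge0 ltW.
have -> : kern N.+1 u = 1 + u * kern N u.
  rewrite /kern big_ord_recl expr0 mulr_sumr; congr (_ + _).
  by apply: eq_bigr => i _; rewrite -exprS.
apply: le_trans (cmodD _ _) _; rewrite cmod1 cmodM.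
have -> : (1 - q)^-1 = 1 + q * (1 - q)^-1 by field; rewrite subr_eq0 gt_eqF.
by rewrite lerD2l ler_pM ?cmod_ge0.
Qed.

(** The bound is independent of N: the interpolants of one function are
    equicontinuous on smaller discs. *)
Lemma kern_lip N (u v : C) (q : R) : q < 1 -> cmod u <= q -> cmod v <= q ->
  cmod (kern N u - kern N v) <= cmod (u - v) * (1 - q)^-1 ^+ 2.
Proof.
move=> q1 uq vq; have q0 : 0 <= q by exact: le_trans (cmod_ge0 _) uq.
have A0 : 0 < (1 - q)^-1 by rewrite invr_gt0 subr_gt0.
elim: N => [|N IH].
  by rewrite /kern !big_ord0 subrr cmod0 mulr_ge0 ?cmod_ge0 ?sqr_ge0.
have E w : kern N.+1 w = 1 + w * kern N w.
  rewrite /kern big_ord_recl expr0 mulr_sumr; congr (_ + _).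
  by apply: eq_bigr => i _; rewrite -exprS.
rewrite !E.
have -> : 1 + u * kern N u - (1 + v * kern N v) =
   (u - v) * kern N u + v * (kern N u - kern N v) by ring.
apply: le_trans (cmodD _ _) _; rewrite !cmodM.
have k1 := kern_le N q1 uq.
have h1 : cmod (u - v) * cmod (kern N u) <= cmod (u - v) * (1 - q)^-1.
  by rewrite ler_wpM2l ?cmod_ge0.
have h2 : cmod v * cmod (kern N u - kern N v) <= q * (cmod (u - v) * (1 - q)^-1 ^+ 2).
  by rewrite ler_pM ?cmod_ge0.
apply: le_trans (lerD h1 h2) _.
rewrite le_eqVlt; apply/orP; left; apply/eqP; field.
by rewrite subr_eq0 gt_eqF.
Qed.

End Topology.
Arguments polyball {R} d r.

Section Slices.
Context {R : realType} {d : nat}.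
Local Notation C := (CC R).
Implicit Types (x : 'rV[C]_d) (j : 'I_d) (t : C) (F : 'rV[C]_d -> C).

(** The point x with its coordinate j replaced by t. *)
Definition upd x j t : 'rV[C]_d := \row_i (if i == j then t else x ord0 i).

Lemma upd_delta x j t : upd x j t = x + (t - x ord0 j) *: delta_mx ord0 j.
Proof.
apply/rowP => i; rewrite !mxE eqxx /=; case: eqP => [->|_].
  by rewrite mulr1 addrC subrK.
by rewrite mulr0 addr0.
Qed.

Lemma upd_id x j : upd x j (x ord0 j) = x.
Proof. by rewrite upd_delta subrr scale0r addr0. Qed.

Lemma differentiable_upd x j t : differentiable (fun y => upd y j t) x.
Proof.
have -> : (fun y => upd y j t) = (fun y => y + (t - y ord0 j) *: delta_mx ord0 j).
  by apply/funext => y; exact: upd_delta.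
apply: differentiableD; first exact: (@ex_diff _ _ _ _ _ id).
apply: differentiableZl; apply: differentiableB; first exact: differentiable_cst.
exact: differentiable_coord.
Qed.

(** Restriction to a complex line parallel to a coordinate axis. *)
Lemma cdiff_slice F x j t : differentiable F (upd x j t) ->
  cdiff (fun s => F (upd x j s)) t.
Proof.
move=> /(@diff_derivable _ _ _ _ _ (delta_mx ord0 j)).
set a := upd x j t => /cvg_cmod H.
set D := lim _ in H; exists D => e e0.
have [k /= k0 kH] := H e e0.
have [l kE l0] := posCE k0.
exists l => // s sl.
have [->|st] := eqVneq s t; first by rewrite !subrr mulr0 subr0 cmod0 mulr0.
have st0 : s - t != 0 by rewrite subr_eq0.
have := kH (s - t); rewrite /ball_ /= sub0r normrN normCE kE ltCE => /(_ sl st0).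
have -> : (s - t) *: delta_mx ord0 j + a = upd x j s.
  by rewrite /a !upd_delta addrC -addrA -scalerDl; congr (_ + _ *: _); ring.
move=> Hs.
have -> : F (upd x j s) - F a - D * (s - t) =
    (s - t) * ((s - t)^-1 * (F (upd x j s) - F a) - D).
  rewrite [RHS]mulrBr mulrA divff// mul1r [D * _]mulrC//.
by rewrite cmodM mulrC ler_wpM2r ?cmod_ge0// ltW.
Qed.

Lemma upd_continuous j (p : 'rV[C]_d * C) :
  {for p, continuous (fun p : 'rV[C]_d * C => upd p.1 j p.2)}.
Proof.
have -> : (fun p : 'rV[C]_d * C => upd p.1 j p.2) =
    (fun p => p.1 + (p.2 - p.1 ord0 j) *: delta_mx ord0 j).
  by apply/funext => q; exact: upd_delta.
apply: cvgD; first exact: cvg_fst.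
apply: cvgZr_tmp; apply: cvgB; first exact: cvg_snd.
apply: (@continuous_comp _ _ _ fst (fun x : 'rV[C]_d => x ord0 j)); first exact: cvg_fst.
exact: coord_continuous.
Qed.

End Slices.

(** * Polynomial approximation in several variables *)

Section Approximation.
Context {R : realType}.
Local Notation C := (CC R).

Section OneRadius.
Variables (r : R).
Hypothesis r01 : 0 < r < 1.
Let rho := (1 + r) / 2.

Let rho01 : 0 < rho < 1.
Proof. by move: r01; rewrite /rho => /andP[? ?]; apply/andP; split; lra. Qed.
Let rho_gt0 : 0 < rho. Proof. by case/andP: rho01. Qed.
Let r_rho : r < rho.
Proof. by move: r01; rewrite /rho => /andP[? ?]; lra. Qed.

(** Joint equicontinuity of interpolation in the function and in the point. *)
Lemma interp_diff (g g' : C -> C) (z z' : C) (eta M : R) n :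
  cmod z <= r -> cmod z' <= r ->
  (forall t, cmod t <= rho -> cmod (g' t - g t) <= eta) ->
  (forall t, cmod t <= rho -> cmod (g t) <= M) ->
  cmod (interp rho g' n z' - interp rho g n z) <=
  eta * (1 - r / rho)^-1 + M * (cmod (z' - z) / rho * (1 - r / rho)^-1 ^+ 2).
Proof.
move=> zr zr' gg' gM.
have q1 : r / rho < 1 by rewrite ltr_pdivrMr// mul1r.
have N0 : (0 : R) < (2 ^ n)%N%:R by rewrite ltr0n expn_gt0.
rewrite /interp -mulrBr -sumrB cmodM cmodV cmod_nat mulrC ler_pdivrMr// [leRHS]mulrC.
apply: cmod_sum_ord => k.
set t := node _ _ _.
have tr : cmod t = rho by exact: cmod_node.
have bnd w : cmod w <= r -> cmod (w / t) <= r / rho.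
  by move=> wr; rewrite cmodM cmodV tr ler_pM2r// invr_gt0.
have -> : g' t * kern (2 ^ n) (z' / t) - g t * kern (2 ^ n) (z / t) =
   (g' t - g t) * kern (2 ^ n) (z' / t) +
   g t * (kern (2 ^ n) (z' / t) - kern (2 ^ n) (z / t)) by ring.
apply: le_trans (cmodD _ _) _; rewrite 2!cmodM; apply: lerD.
  apply: ler_pM; rewrite ?cmod_ge0//; first by apply: gg'; rewrite tr.
  by apply: kern_le => //; exact: bnd.
apply: ler_pM; rewrite ?cmod_ge0//; first by apply: gM; rewrite tr.
apply: le_trans (kern_lip _ q1 (bnd _ zr') (bnd _ zr)) _.
by rewrite -mulrBl cmodM cmodV tr.
Qed.

Variable d : nat.
Implicit Types F : 'rV[C]_d -> C.

Lemma polydisc_upd (x : 'rV[C]_d) (j : 'I_d) (t : C) :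
  polydisc C d x -> cmod t < 1 -> polydisc C d (upd x j t).
Proof.
move=> /polydiscE xD t1; apply/polydiscE => i; rewrite mxE.
by case: ifP.
Qed.

Lemma polyball_polydisc (x : 'rV[C]_d) : polyball d r x -> polydisc C d x.
Proof.
move=> xr; apply/polydiscE => j; apply: le_lt_trans (xr j) _.
by case/andP: r01.
Qed.

(** Pointwise convergence of the interpolants in the variable j at x becomes
    locally uniform by equicontinuity. The parameters in the other coordinates
    vary too, and compactness of the circle of nodes makes the slices at y
    uniformly close to the slice at x. *)
Lemma interp_local F (j : 'I_d) (x : 'rV[C]_d) (e : R) :
  (forall y, polydisc C d y -> differentiable F y) ->
  polyball d r x -> 0 < e ->
  \forall y \near x & n \near \oo, polyball d r y ->
    cmod (interp rho (fun t => F (upd y j t)) n (y ord0 j) - F y) <= e.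
Proof.
move=> dF xr e0.
have rho1 : rho < 1 by case/andP: rho01.
have xD := polyball_polydisc xr.
have uD (t : C) : cmod t <= rho -> polydisc C d (upd x j t).
  by move=> tr; apply: polydisc_upd => //; exact: le_lt_trans tr rho1.
have cF y : polydisc C d y -> {for y, continuous F}.
  by move=> /dF; exact: differentiable_continuous.
have cU (t : C) : cmod t <= rho ->
    {for (x, t), continuous (fun p : 'rV[C]_d * C => F (upd p.1 j p.2))}.
  move=> tr; apply: (@continuous_comp _ _ _ (fun p : 'rV[C]_d * C => upd p.1 j p.2) F).
    exact: (@upd_continuous R d j (x, t)).
  by apply: cF; exact: uD.
have cT (t : C) : cmod t <= rho -> {for t, continuous (fun s => F (upd x j s))}.
  move=> tr; apply: (@continuous_comp _ _ _ (fun s : C => (x, s)) (fun p => F (upd p.1 j p.2))).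
    move=> P [[U V] /= [Ux Vt] UV]; apply: (@filterS _ (nbhs t) _ V) => // s Vs.
    by apply: UV; split => //=; exact: nbhs_singleton.
  exact: cU.
have [M HM] : exists M : nat, forall t : C, cmod t <= rho -> cmod (F (upd x j t)) <= M%:R.
  have /compact_near_coveringP cov := @compact_cdisc R rho.
  case: (cov nat \oo (fun n t => cmod (F (upd x j t)) <= n%:R) _) => [|M _ HM]; last first.
    by exists M => t tr; exact: (HM M (leqnn M)).
  move=> t0 t0r /=.
  have := (iffLR (continuous_cmod _ _) (cT _ t0r)) 1 ltr01 => H.
  pose m := Num.bound (cmod (F (upd x j t0)) + 1).
  exists ([set t | cmod (F (upd x j t) - F (upd x j t0)) < 1], [set n | (m <= n)%N]).
    by split => //; exact: nbhs_infty_ge.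
  move=> [t n] /= [Ht mn].
  have := cmodD (F (upd x j t) - F (upd x j t0)) (F (upd x j t0)); rewrite subrK => H1.
  have H2 : cmod (F (upd x j t0)) + 1 < m%:R.
    by apply: archi_boundP; rewrite addr_ge0 ?cmod_ge0.
  have H3 : m%:R <= n%:R :> R by rewrite ler_nat.
  lra.
pose A := (1 - r / rho)^-1.
have A0 : 0 < A by rewrite invr_gt0 subr_gt0 ltr_pdivrMr// mul1r.
pose eta := e / 4 / A; have eta0 : 0 < eta by rewrite !divr_gt0.
have near_slice : \forall y \near x, forall t : C, cmod t <= rho ->
    cmod (F (upd y j t) - F (upd x j t)) <= eta.
  have /compact_near_coveringP cov := @compact_cdisc R rho.
  apply: (cov _ (nbhs x) (fun y t => cmod (F (upd y j t) - F (upd x j t)) <= eta)).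
  move=> t0 t0r.
  have eta2 : 0 < eta / 2 by rewrite divr_gt0.
  have := (iffLR (continuous_cmod _ _) (cU _ t0r)) _ eta2.
  move=> [[U V] /= [Ux Vt] UV].
  have := (iffLR (continuous_cmod _ _) (cT _ t0r)) _ eta2 => H.
  exists ([set t | V t /\ cmod (F (upd x j t) - F (upd x j t0)) < eta / 2], U).
    by split => //; exact: filterI.
  move=> [t y] /= [[Vt' h1] Uy].
  have h2 : cmod (F (upd y j t) - F (upd x j t0)) < eta / 2 by exact: (UV (y, t)).
  have := cmodB (F (upd y j t) - F (upd x j t0)) (F (upd x j t) - F (upd x j t0)).
  rewrite (_ : _ - _ - _ = F (upd y j t) - F (upd x j t)); last by ring.
  lra.
pose del := e / 4 * rho / (M.+1%:R * A ^+ 2).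
have e4 : 0 < e / 4 by rewrite divr_gt0.
have del0 : 0 < del.
  by apply: divr_gt0; apply: mulr_gt0; rewrite ?exprn_gt0 ?ltr0n.
have near_coord : \forall y \near x, cmod ((y : 'rV[C]_d) ord0 j - x ord0 j) < del.
  by apply: (iffLR (continuous_cmod (fun y : 'rV[C]_d => y ord0 j) x)) => //; exact: coord_continuous.
have near_F : \forall y \near x, cmod (F y - F x) < e / 4.
  by apply: (iffLR (continuous_cmod F x)) => //; exact: cF.
have [n0 Hn0] := @interp_cvg R rho rho01 (fun t => F (upd x j t)) (x ord0 j)
   (fun t t1 => cdiff_slice (dF _ (polydisc_upd j xD t1)))
   (le_lt_trans (xr j) r_rho) (e / 4) e4.
exists ([set y | [/\ (forall t : C, cmod t <= rho -> cmod (F (upd y j t) - F (upd x j t)) <= eta),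
   cmod (y ord0 j - x ord0 j) < del & cmod (F y - F x) < e / 4]],
   [set n | (n0 <= n)%N]).
  split; last exact: nbhs_infty_ge.
  by near=> y; split; near: y.
move=> [y n] /= [[h1 h2 h3] n0n] yr.
have k1 := Hn0 n n0n; rewrite upd_id in k1.
have k2 := interp_diff n (xr j) (yr j) h1 HM; rewrite -/A in k2.
have k3 : eta * A = e / 4 by rewrite /eta divfK// gt_eqF.
have k4 : M%:R * (cmod (y ord0 j - x ord0 j) / rho * A ^+ 2) <= e / 4.
  apply: (@le_trans _ _ (M.+1%:R * (del / rho * A ^+ 2))).
    apply: ler_pM; rewrite ?ler0n ?ler_nat//.
      by rewrite mulr_ge0 ?sqr_ge0// divr_ge0 ?cmod_ge0// ltW.
    by rewrite ler_wpM2r ?sqr_ge0// ler_pM2r ?invr_gt0// ltW.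
  rewrite /del le_eqVlt; apply/orP; left; apply/eqP; field.
  by rewrite !gt_eqF//= nat1r ltr0n.
set I' := interp _ _ _ (y ord0 j) in k2 *; set I := interp _ _ _ _ in k1 k2.
have := cmodD (I' - I) (I - F x - (F y - F x)).
have := cmodB (I - F x) (F y - F x).
rewrite (_ : I' - I + _ = I' - F y); last by ring.
lra.
Unshelve. all: by end_near. Qed.

Lemma interp_uniform F (j : 'I_d) (e : R) :
  (forall y, polydisc C d y -> differentiable F y) -> 0 < e ->
  exists n, forall y, polyball d r y ->
    cmod (interp rho (fun t => F (upd y j t)) n (y ord0 j) - F y) <= e.
Proof.
move=> dF e0.
have /compact_near_coveringP/near_covering_withinP := @compact_polyball R d r.
move=> /(_ nat \oo (fun n y =>
  cmod (interp rho (fun t => F (upd y j t)) n (y ord0 j) - F y) <= e)).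
case=> [x xr|n _ Hn]; first exact: interp_local.
by exists n; exact: (Hn n (leqnn n)).
Qed.

(** The coefficient of the m-th power of the j-th coordinate in the interpolant;
    it is holomorphic in the other coordinates. *)
Definition interp_coef F (j : 'I_d) n m (x : 'rV[C]_d) : C :=
  (2 ^ n)%N%:R^-1 * \sum_(k < 2 ^ n) (node rho n k) ^- m * F (upd x j (node rho n k)).

Lemma interp_expand F (j : 'I_d) n (x : 'rV[C]_d) (z : C) :
  interp rho (fun t => F (upd x j t)) n z =
  \sum_(m < 2 ^ n) z ^+ m * interp_coef F j n m x.
Proof.
transitivity (\sum_(m < 2 ^ n) \sum_(k < 2 ^ n)
  (2 ^ n)%N%:R^-1 * (z ^+ m * ((node rho n k : C) ^- m * F (upd x j (node rho n k))))).
  rewrite exchange_big /= /interp mulr_sumr; apply: eq_bigr => k _.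
  rewrite /kern !mulr_sumr; apply: eq_bigr => m _.
  by rewrite exprMn exprVn; ring.
apply: eq_bigr => m _; rewrite /interp_coef mulrCA !mulr_sumr.
by apply: eq_bigr => k _.
Qed.

Lemma interp_coef_differentiable F j n m :
  (forall y, polydisc C d y -> differentiable F y) ->
  forall y, polydisc C d y -> differentiable (interp_coef F j n m) y.
Proof.
move=> dF y yD.
rewrite (_ : interp_coef F j n m = ((2 ^ n)%N%:R^-1 : C) *: (\sum_(k < 2 ^ n)
  (((node rho n k : C) ^- m) *: (fun x => F (upd x j (node rho n k)))))); last first.
  by apply/funext => x; rewrite /interp_coef fctE fct_sumE.
apply: differentiableZ; apply: differentiable_sum => k; apply: differentiableZ.
apply: (@differentiable_comp _ _ _ _ (fun x => upd x j (node rho n k)) F).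
  exact: differentiable_upd.
apply: dF; apply: polydisc_upd => //; rewrite cmod_node//.
by case/andP: rho01.
Qed.

(** Induction on the number k of coordinates on which F depends: interpolating
    in the last of them leaves coefficients that depend on k - 1 coordinates.
    Powers of a coordinate are bounded by 1, so the errors made in approximating
    the coefficients add up. *)
Lemma poly_approx_dep k F :
  (forall y, polydisc C d y -> differentiable F y) ->
  (forall x y, polydisc C d x -> polydisc C d y ->
     (forall j : 'I_d, (j < k)%N -> x ord0 j = y ord0 j) -> F x = F y) ->
  forall e : R, 0 < e -> exists p : mpoly d C, forall x, polyball d r x ->
    cmod (F x - meval (x ord0) p) <= e.
Proof.
elim: k F => [|k IH] F dF indep e e0.
  exists (mpolyC d (F 0)) => x xr; rewrite mevalC (indep x 0) ?subrr ?cmod0 ?ltW//.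
    exact: polyball_polydisc.
  by apply/polydiscE => j; rewrite mxE cmod0.
have [kd|dk] := ltnP k d; last first.
  apply: IH => // x y xD yD xy; apply: indep => // j _.
  by apply: xy; exact: leq_trans (ltn_ord j) dk.
pose j := Ordinal kd.
have e2 : 0 < e / 2 by rewrite divr_gt0.
have [n Hn] := interp_uniform j dF e2.
have N0 : (0 : R) < (2 ^ n)%N%:R by rewrite ltr0n expn_gt0.
have eN : 0 < e / 2 / (2 ^ n)%N%:R by rewrite divr_gt0.
have coefs (m : 'I_(2 ^ n)) : exists p : mpoly d C, forall x, polyball d r x ->
    cmod (interp_coef F j n m x - meval (x ord0) p) <= e / 2 / (2 ^ n)%N%:R.
  apply: IH eN; first exact: interp_coef_differentiable.
  move=> x y xD yD xy; congr (_ * _); apply: eq_bigr => l _; congr (_ * _).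
  have n1 : cmod (node rho n l) < 1 by rewrite cmod_node//; case/andP: rho01.
  apply: indep; [exact: polydisc_upd|exact: polydisc_upd|] => i ik.
  rewrite !mxE; case: eqP => // ij; apply: xy.
  by move: ik; rewrite ltnS leq_eqVlt => /orP[/eqP ik|//]; case: ij; exact/val_inj.
have [P HP] := choice coefs.
exists (\sum_(m < 2 ^ n) mpolyX C (mnm1 j) ^+ m * P m) => x xr.
rewrite (raddf_sum (meval (x ord0))).

have k1 := Hn x xr; rewrite interp_expand in k1.
have k2 : cmod (\sum_(m < 2 ^ n) x ord0 j ^+ m * interp_coef F j n m x -
    \sum_(m < 2 ^ n) meval (x ord0) (mpolyX C (mnm1 j) ^+ m * P m)) <= e / 2.
  rewrite -sumrB -[leRHS](divfK (lt0r_neq0 N0)) [leRHS]mulrC.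
  apply: cmod_sum_ord => m; rewrite mevalM rmorphXn /= mevalXU -mulrBr cmodM.
  apply: le_trans (HP m x xr); rewrite ler_piMl ?cmod_ge0// cmodX exprn_ile1 ?cmod_ge0//.
  by apply: le_trans (xr j) _; rewrite ltW//; case/andP: r01.
set I := \sum_(m < 2 ^ n) x ord0 j ^+ m * _ in k1 k2.
set J := \sum_(m < 2 ^ n) meval _ _ in k2 *.
have := cmodB (I - J) (I - F x).
rewrite (_ : I - J - _ = F x - J); last by ring.
lra.
Qed.

Theorem poly_approx F :
  (forall y, polydisc C d y -> differentiable F y) ->
  forall e : R, 0 < e -> exists p : mpoly d C, forall x, polyball d r x ->
    cmod (F x - meval (x ord0) p) <= e.
Proof.
move=> dF; apply: (@poly_approx_dep d) => // x y xD yD xy; congr F.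
by apply/rowP => j; apply: xy.
Qed.

End OneRadius.
End Approximation.

(** * The closed polydisc and its dilations *)

Section ClosedPolydisc.
Context {R : realType} {d : nat}.
Local Notation C := (CC R).
Local Notation K := (closed_polydisc C d).
Local Notation act := (@Defs.perm_action C d).

Lemma toC1 : toC 1 = 1 :> C. Proof. by []. Qed.

Lemma toCB a b : toC (a - b) = toC a - toC b :> C.
Proof. exact: rmorphB. Qed.

Lemma cmod_toC a : cmod (toC a : C) = `|a|.
Proof. exact: cmod_real. Qed.

Lemma closure_unit_disc (z : C) : closure (unit_disc C) z <-> cmod z <= 1.
Proof.
split=> [zc|z1].
  suff : [set z : C | cmod z <= 1] z by [].
  have /closure_id -> := @closed_cdisc R 1.
  by apply: closure_subset zc => t /unit_discE /ltW.
move=> U /nbhs_ballP[e /= /posCE[k -> k0] kU].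
pose s := Num.min 1 (k / 2).
have [s0 s1 sk] : [/\ 0 < s, s <= 1 & s < k].
  rewrite /s lt_min ltr01 divr_gt0// ge_min lexx; split => //.
  by rewrite gt_min; apply/orP; right; lra.
exists (toC (1 - s) * z); split.
  apply/unit_discE; rewrite cmodM cmod_toC ger0_norm ?subr_ge0//.
  apply: (@le_lt_trans _ _ ((1 - s) * 1)); last by lra.
  by rewrite ler_wpM2l ?subr_ge0.
apply: kU; rewrite /ball /= normCE ltCE.
have -> : z - toC (1 - s) * z = toC s * z by rewrite toCB toC1; ring.
rewrite cmodM cmod_toC gtr0_norm//; apply: le_lt_trans sk.
by rewrite ler_piMr// ltW.
Qed.

Lemma closed_polydiscE (x : 'rV[C]_d) : K x <-> polyball d 1 x.
Proof. by split => H j; apply/closure_unit_disc; exact: H. Qed.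

Lemma closed_polydisc_le1 (z : K) : polyball d 1 (val z).
Proof. by apply/closed_polydiscE; exact: set_mem (valP z). Qed.

Definition closed_polydisc_point (x : 'rV[C]_d) (Hx : polyball d 1 x) : K :=
  SigSub (mem_set (iffRL (closed_polydiscE x) Hx)).

Definition shrink n : R := n.+1%:R / n.+2%:R.

Lemma shrink01 n : 0 < shrink n < 1.
Proof.
by rewrite /shrink divr_gt0 ?ltr0n//= ltr_pdivrMr ?ltr0n// mul1r ltr_nat.
Qed.

Lemma dilate_subproof n (z : K) : polyball d 1 (toC (shrink n) *: val z).
Proof.
move=> j; have /andP[r0 r1] := shrink01 n.
rewrite mxE cmodM cmod_toC gtr0_norm// mulr_ile1 ?cmod_ge0 ?(ltW r0) ?(ltW r1)//.
exact: closed_polydisc_le1.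
Qed.

Definition dilate n z : K := closed_polydisc_point (@dilate_subproof n z).

Lemma dilate_ball n z : polyball d (shrink n) (val (dilate n z)).
Proof.
move=> j; have /andP[r0 r1] := shrink01 n.
by rewrite /= mxE cmodM cmod_toC gtr0_norm// ler_piMr ?(ltW r0)//; exact: closed_polydisc_le1.
Qed.

Lemma dilate_polydisc n z : polydisc C d (val (dilate n z)).
Proof.
apply/polydiscE => j; apply: le_lt_trans (dilate_ball n z j) _.
by case/andP: (shrink01 n).
Qed.

(** Neighbourhoods in the closed polydisc are traces of neighbourhoods of row
    vectors. *)
Lemma nbhs_closed_polydisc (z : K) (P : set K) : nbhs z P ->
  exists2 U, nbhs (val z) U & forall w : K, U (val w) -> P w.
Proof.
move=> [Q [[U oU UQ] Qz] QP]; exists U.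
  by apply: open_nbhs_nbhs; split => //; rewrite -UQ in Qz.
by move=> w Uw; apply: QP; rewrite -UQ.
Qed.

Lemma val_continuous : continuous (val : K -> 'rV[C]_d).
Proof. exact: initial_continuous. Qed.

Lemma compact_closed_polydisc : compact [set: K].
Proof.
apply/compact_near_coveringP => I F P FF H.
have /compact_near_coveringP/near_covering_withinP cov := @compact_polyball R d 1.
have PF : \forall i \near F, polyball d 1 `<=` (fun x => forall z : K, val z = x -> P i z).
  apply: cov => x xb.
  have [[U V] /= [Uz Vn] UV] := H (closed_polydisc_point xb) Logic.I.
  have [W Wx WU] := nbhs_closed_polydisc Uz.
  exists (W, V) => // -[y n] /= [Wy Vn'] yb z zy.
  by rewrite -zy in Wy; apply: (UV (z, n)); split => //=; exact: WU.
by apply: filterS PF => i Hi z _; exact: (Hi (val z) (closed_polydisc_le1 z)).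
Qed.

Lemma shrink_cvg : (fun n => toC (shrink n) : C) @ \oo --> (1 : C).
Proof.
apply/cvg_cmod => e e0.
near=> n.
have -> : toC (shrink n) - 1 = - toC (n.+2%:R^-1) :> C.
  rewrite -toC1 -toCB -[RHS](rmorphN (real_complex R)); congr toC.
  rewrite /shrink -[X in _ - X](@divff _ n.+2%:R) ?pnatr_eq0// -mulrBl.
  by rewrite -[n.+2%:R]natr1 opprD addrA subrr sub0r mulN1r.
rewrite cmodN cmod_toC ger0_norm ?invr_ge0//.
rewrite invf_plt ?posrE ?ltr0n//.
apply: (@lt_trans _ _ n%:R); last by rewrite ltr_nat.
near: n; exact: nbhs_infty_gtr.
Unshelve. all: by end_near. Qed.

(** Near z both w and its dilation are close to z when the ratio is close to 1;
    compactness makes this uniform. *)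
Lemma dilate_uniform (f : K -> C) (e : R) : continuous f -> 0 < e ->
  exists n, forall z, cmod (f z - f (dilate n z)) <= e.
Proof.
move=> cf e0.
have [n _ Hn] : \forall n \near \oo, forall z, cmod (f z - f (dilate n z)) <= e.
  have /compact_near_coveringP cov := compact_closed_polydisc.
  suff : \forall n \near \oo, [set: K] `<=` (fun z => cmod (f z - f (dilate n z)) <= e).
    by apply: filterS => n Hn z; exact: Hn.
  apply: cov => z _.
  have e2 : 0 < e / 2 by rewrite divr_gt0.
  have := iffLR (continuous_cmod f z) (cf z) _ e2 => /nbhs_closed_polydisc[U Uz UP].
  have : nbhs (1 *: val z) U by rewrite scale1r.
  move=> /(scale_continuous (1 : C, val z)) [[V W] /= [V1 Wz] VW].
  exists (val @^-1` (U `&` W), [set n | V (toC (shrink n))]).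
    split; last exact: shrink_cvg V1.
    by apply: val_continuous; exact: filterI.
  move=> [w n] /= [[Uw Ww] Vn].
  have h1 := UP w Uw.
  have h2 : cmod (f (dilate n w) - f z) < e / 2.
    by apply: UP; apply: (VW (toC (shrink n), val w)).
  have := cmodB (f w - f z) (f (dilate n w) - f z).
  rewrite (_ : _ - _ - _ = f w - f (dilate n w)); last by ring.
  lra.
by exists n; exact: (Hn n (leqnn n)).
Qed.

Lemma dilate_perm n (s : 'S_d) (z : K) : dilate n (act s z) = act s (dilate n z).
Proof. by apply/val_inj/rowP => j; rewrite !mxE. Qed.

Lemma eq_of_cmod_le (a b : C) : (forall e : R, 0 < e -> cmod (a - b) <= e) -> a = b.
Proof.
move=> H; apply/eqP; rewrite -subr_eq0 -cmod_eq0 eq_le cmod_ge0 andbT.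
apply/ler_addgt0Pr => e e0; rewrite add0r; exact: H.
Qed.

(** Symmetry is required in the open polydisc only; it extends to the boundary
    by dilation, which commutes with permutations. *)
Lemma asym_symmetric (f : Asym C d) s z : f (act s z) = f z.
Proof.
have /sym_polydisc_algebraP [_ cf sf] := Asym_funP f.
apply: eq_of_cmod_le => e e0.
have e2 : 0 < e / 2 by rewrite divr_gt0.
have [n Hn] := dilate_uniform cf e2.
have h1 := Hn z; have := Hn (act s z).
rewrite dilate_perm (sf _ _ (dilate_polydisc n z)).
set b := f (dilate n z) in h1 * => h2.
have := cmodB (f (act s z) - b) (f z - b).
rewrite (_ : _ - _ - _ = f (act s z) - f z); last by ring.
lra.
Qed.

End ClosedPolydisc.

(** * Symmetric polynomials, inverses and characters *)

(** A ring morphism that splits the structure map c commutes with substitution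
    into a polynomial. *)
Lemma meval_mmap n (C : comNzRingType) (A : nzRingType) (phi : A -> C) (c : C -> A)
    (h : 'I_n -> A) (q : mpoly n C) :
  phi 0 = 0 -> {morph phi : a b / a + b} -> phi 1 = 1 ->
  {morph phi : a b / a * b} -> (forall x, phi (c x) = x) ->
  phi (mmap c h q) = meval (phi \o h) q.
Proof.
move=> p0 pD p1 pM pc.
rewrite mevalE /mmap (big_morph phi pD p0); apply: eq_bigr => m _.
rewrite pM pc /mmap1 (big_morph phi pM p1); congr (_ * _).
apply: eq_bigr => i _; elim: (m i) => [|k IH]; first by rewrite !expr0 p1.
by rewrite !exprS pM IH.
Qed.

Section Characters.
Context {R : realType} {d : nat}.
Local Notation C := (CC R).
Local Notation K := (closed_polydisc C d).
Local Notation act := (@Defs.perm_action C d).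
Local Notation A := (Asym C d).

Definition peval (p : mpoly d C) (x : 'rV[C]_d) : C := meval (x ord0) p.

Lemma meval_msym (s : 'S_d) (p : mpoly d C) (v : 'I_d -> C) :
  meval v (msym s p) = meval (v \o s) p.
Proof.
rewrite /msym (@meval_mmap _ _ _ (meval v)).
- by apply: meval_eq => i /=; rewrite mevalXU.
- exact: meval0.
- exact: mevalD.
- exact: meval1.
- exact: mevalM.
- exact: mevalC.
Qed.

Lemma peval_perm (p : mpoly d C) (s : 'S_d) x :
  p \is symmetric -> peval p (col_perm s x) = peval p x.
Proof.
move=> /issymP/(_ s) ps; rewrite /peval -[in RHS]ps meval_msym.
by apply: meval_eq => i; rewrite mxE.
Qed.

Lemma peval_differentiable (p : mpoly d C) x : differentiable (peval p) x.
Proof.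
have dX (i : 'I_d) k : differentiable (fun y : 'rV[C]_d => y ord0 i ^+ k) x.
  elim: k => [|k IH].
    by rewrite (_ : (fun _ => _) = cst 1); [exact: differentiable_cst|apply/funext].
  rewrite (_ : (fun _ => _) = (fun y : 'rV[C]_d => y ord0 i) * (fun y => y ord0 i ^+ k)).
    by apply: differentiableM => //; exact: differentiable_coord.
  by apply/funext => y; rewrite exprS.
rewrite (_ : peval p = \sum_(m <- msupp p)
   (mcoeff m p *: \prod_(i < d) (fun y : 'rV[C]_d => y ord0 i ^+ m i))); last first.
  apply/funext => y; rewrite /peval mevalE fct_sumE; apply: eq_bigr => m _.
  rewrite fctE; congr (_ * _).
  by elim/big_rec2: _ => [//|i a b _ ->].
elim/big_ind: _ => [|f g df dg|m _].
- exact: differentiable_cst.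
- exact: differentiableD.
apply: differentiableZ; elim/big_ind: _ => [|f g df dg|i _].
- exact: differentiable_cst.
- exact: differentiableM.
- exact: dX.
Qed.

Lemma sym_poly_in_asym (p : mpoly d C) : p \is symmetric ->
  (fun z : K => peval p (val z)) \in @sym_polydisc_algebra C d.
Proof.
move=> ps; apply/sym_polydisc_algebraP; split.
- by exists (peval p); split => // x _; exact: peval_differentiable.
- move=> z; apply: (@continuous_comp K 'rV[C]_d C val (peval p) z); first exact: val_continuous.
  exact/differentiable_continuous/peval_differentiable.
- by move=> s z _; exact: peval_perm.
Qed.

Definition sym_poly_asym p (ps : p \is symmetric) : A := MkAsym (sym_poly_in_asym ps).

(** Membership in the maximal ideal space, for plain functions. *)
Definition is_char (phi : A -> C) :=
  [/\ scalar phi, {morph phi : a b / a * b} & exists a, phi a != 0].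

Definition ev (z : K) (f : A) : C := f z.

Lemma ev_char z : is_char (ev z).
Proof. by split => //; exists 1; exact: oner_neq0. Qed.

Section OneChar.
Variable phi : A -> C.
Hypothesis phiP : is_char phi.

Lemma char_zero : phi 0 = 0.
Proof.
by have [lin _ _] := phiP; have := lin (-1) 0 0; rewrite scaler0 addr0 mulN1r addNr.
Qed.

Lemma char_add : {morph phi : a b / a + b}.
Proof.
by move=> a b; have [lin _ _] := phiP; have := lin 1 a b; rewrite scale1r mul1r.
Qed.

Lemma char_mul : {morph phi : a b / a * b}.
Proof. by have [] := phiP. Qed.

Lemma char_scale c a : phi (c *: a) = c * phi a.
Proof.
by have [lin _ _] := phiP; have := lin c a 0; rewrite !addr0 char_zero addr0.
Qed.

Lemma char_opp : {morph phi : a / - a}.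
Proof. by move=> a; rewrite -scaleN1r char_scale mulN1r. Qed.

Lemma char_sub : {morph phi : a b / a - b}.
Proof. by move=> a b; rewrite char_add char_opp. Qed.

Lemma char_one : phi 1 = 1.
Proof.
have [_ _ [a a0]] := phiP; apply: (mulfI a0).
by rewrite -char_mul !mulr1.
Qed.

Lemma char_const c : phi (c%:A) = c.
Proof. by rewrite char_scale char_one mulr1. Qed.

Lemma char_mmap (h : 'I_d -> A) q :
  phi (mmap (in_alg A) h q) = meval (phi \o h) q.
Proof.
apply: meval_mmap; [exact: char_zero|exact: char_add|exact: char_one|exact: char_mul|exact: char_const].
Qed.

End OneChar.

(** The algebra is inverse-closed in the continuous functions, which is what
    makes its characters contractive. *)
Lemma asym_inverse (f : A) : (forall z, f z != 0) -> exists g : A, f * g = 1.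
Proof.
move=> f0.
have /sym_polydisc_algebraP [[F [fF dF]] cf sf] := Asym_funP f.
have gP : (fun z => (f z)^-1) \in @sym_polydisc_algebra C d.
  apply/sym_polydisc_algebraP; split.
  - exists (fun x => (F x)^-1); split => [z zD|x xD]; first by rewrite fF.
    apply: differentiableV; first exact: dF.
    have xb : polyball d 1 x by move=> j; apply/ltW; exact: (iffLR (polydiscE x) xD).
    by have := f0 (closed_polydisc_point xb); rewrite fF.
  - by move=> z; exact: (@cvgV C K (nbhs z) _ f (f z) (f0 z) (cf z)).
  - by move=> s z zD; rewrite sf.
exists (MkAsym gP); apply/val_inj/funext => z /=.
by rewrite fctE /= divff.
Qed.

(** Otherwise f - phi f is invertible, but it lies in the kernel of phi. *)
Lemma char_range (phi : A -> C) (f : A) : is_char phi -> exists z, f z = phi f.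
Proof.
move=> ph; apply: contrapT => nz.
have [|g /(congr1 phi)] := @asym_inverse (f - (phi f)%:A).
  move=> z; apply/eqP => /= fz; apply: nz; exists z.
  move: fz; rewrite !fctE /= => /eqP; rewrite subr_eq0 => /eqP ->.
  exact: mulr1.
rewrite (char_mul ph) (char_sub ph) (char_const ph) subrr mul0r (char_one ph) => /esym/eqP.
by rewrite oner_eq0.
Qed.

Lemma char_le (phi : A -> C) (f g : A) (M : R) : is_char phi ->
  (forall z, cmod (f z - g z) <= M) -> cmod (phi f - phi g) <= M.
Proof.
move=> ph H; rewrite -(char_sub ph); have [z <-] := char_range (f - g) ph.
exact: H.
Qed.

End Characters.

(** * Characters are point evaluations *)

Section Evaluation.
Context {R : realType} {d : nat}.
Local Notation C := (CC R).
Local Notation K := (closed_polydisc C d).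
Local Notation act := (@Defs.perm_action C d).
Local Notation A := (Asym C d).

Definition esym_asym k : A := sym_poly_asym (mesym_sym d C k).

(** The fundamental theorem on symmetric polynomials, read both in the algebra
    and pointwise with the same outer polynomial q. *)
Lemma sym_poly_through_esym (p : mpoly d C) (ps : p \is symmetric) :
  exists q : mpoly d C,
    sym_poly_asym ps = mmap (in_alg A) (fun i : 'I_d => esym_asym i.+1) q /\
    forall v, meval v p = meval (fun i : 'I_d => meval v (mesym d C i.+1)) q.
Proof.
have [q [qp _]] := sym_fundamental ps; exists q.
have E v : meval v p = meval (fun i : 'I_d => meval v (mesym d C i.+1)) q.
  by rewrite -qp comp_mpoly_meval; apply: meval_eq => i; rewrite tnth_mktuple.
split => //; apply/val_inj/funext => z /=.
by rewrite -[RHS]/(ev z _) (char_mmap (ev_char z)) /peval E.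
Qed.

(** Dilate f, approximate it on the smaller polydisc, undo the dilation in the
    polynomial, and average over the symmetric group. *)
Lemma dense_sym_poly (f : A) (e : R) : 0 < e ->
  exists p : mpoly d C, exists ps : p \is symmetric,
    forall z, cmod (f z - sym_poly_asym ps z) <= e.
Proof.
move=> e0; have e2 : 0 < e / 2 by rewrite divr_gt0.
have /sym_polydisc_algebraP [[F [fF dF]] cf sf] := Asym_funP f.
have [n Hn] := dilate_uniform cf e2.
have [p0 Hp0] := poly_approx (shrink01 n) dF e2.
pose q := comp_mpoly [tuple toC (shrink n) *: mpolyX C (mnm1 i) | i < d] p0.
have Hq (z : K) : cmod (f z - peval q (val z)) <= e.
  have -> : peval q (val z) = peval p0 (val (dilate n z)).
    rewrite /peval comp_mpoly_meval; apply: meval_eq => i.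
    by rewrite tnth_mktuple mevalZ mevalXU /= mxE.
  have h1 := Hn z; have := Hp0 _ (dilate_ball n z).
  rewrite -fF; last exact: dilate_polydisc.
  set a := f (dilate n z) in h1 *; rewrite /peval => h2.
  have := cmodD (f z - a) (a - meval (val (dilate n z) ord0) p0).
  by rewrite addrA subrK; lra.
pose N := #|{: 'S_d}|.
have N0 : (0 < N)%N by apply/card_gt0P; exists 1%g.
have NC : (N%:R : C) != 0 by rewrite pnatr_eq0 -lt0n.
pose p : mpoly d C := (N%:R : C)^-1 *: \sum_(s : 'S_d) msym s q.
have ps : p \is symmetric.
  apply/issymP => s; rewrite /p msymZ (big_morph (msym s) (@msymD d C s) (@msym0 d C s)).
  rewrite [in RHS](reindex_inj (@mulIg {perm 'I_d} s)) /=.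
  by under [in RHS]eq_bigr do rewrite msymMm.
exists p, ps => z.
have -> : f z - sym_poly_asym ps z = N%:R^-1 * \sum_(s : 'S_d) (f (act s z) - peval q (val (act s z))).
  rewrite sumrB mulrBr; congr (_ - _).
    rewrite (eq_bigr (fun=> f z)) => [|s _]; last exact: asym_symmetric.
    by rewrite sumr_const -[f z *+ _]mulr_natl mulrA mulVf// mul1r.
  rewrite -[sym_poly_asym ps z]/(meval (val z ord0) p) /p mevalZ.
  rewrite (big_morph _ (@mevalD d C (val z ord0)) (@meval0 d C (val z ord0))).
  apply: (congr1 (fun t => _ * t)); apply: eq_bigr => s _.
  by rewrite meval_msym; apply: meval_eq => i; rewrite [in RHS]/= mxE.
rewrite cmodM cmodV (cmod_nat N) mulrC ler_pdivrMr ?ltr0n//.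
apply: le_trans (cmod_sum _ _ _) _.
apply: le_trans (ler_sum _ (fun s _ => Hq (act s z))) _.
by rewrite sumr_const -/N mulr_natr.
Qed.

Lemma esym_asym0 : esym_asym 0 = 1.
Proof.
by apply/val_inj/funext => z /=; rewrite /peval mesym0E meval1.
Qed.

(** The roots of the monic polynomial with coefficients (-1)^k c_k, by
    Vieta. *)
Lemma esym_roots (c : nat -> C) : c 0%N = 1 ->
  exists x : d.-tuple C, forall k, (k <= d)%N -> meval (tnth x) (mesym d C k) = c k.
Proof.
move=> c0; pose P := \poly_(k < d.+1) ((-1) ^+ (d - k) * c (d - k)%N).
have [rs rsP] := closed_field_poly_normal P.
have P1 : lead_coef P = 1.
  by rewrite lead_coef_poly ?subnn ?c0 ?expr0 ?mulr1 ?oner_neq0.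
rewrite P1 scale1r in rsP.
have srs : size rs == d.
  have := size_prod_XsubC rs id; rewrite -rsP size_poly_eq.
    by move=> /eqP; rewrite eqSS eq_sym.
  by rewrite subnn c0 mulr1 expr0 oner_neq0.
exists (Tuple srs) => k kd.
have kd' : (k < d.+1)%N by [].
have := mroots_coeff (Tuple srs) (Ordinal kd').
rewrite -rsP coef_poly ltnS leq_subr subKn//= => /mulfI -> //.
by rewrite expf_neq0// oppr_eq0 oner_neq0.
Qed.

Section OneChar.
Variable phi : A -> C.
Hypothesis phiP : is_char phi.

Lemma char_sym_poly (x : 'I_d -> C) :
  (forall k, (k <= d)%N -> meval x (mesym d C k) = phi (esym_asym k)) ->
  forall p (ps : p \is symmetric), phi (sym_poly_asym ps) = meval x p.
Proof.
move=> Hx p ps; have [q [-> ->]] := sym_poly_through_esym ps.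
rewrite (char_mmap phiP); apply: meval_eq => i /=.
by rewrite Hx.
Qed.

Lemma prod_sub_symmetric (c : C) :
  \prod_(i < d) (mpolyC d c - mpolyX C (mnm1 i)) \is symmetric.
Proof.
apply/issymP => s; rewrite rmorph_prod [RHS](reindex_inj (@perm_inj _ s)) /=.
apply: eq_bigr => i _; rewrite msymB; congr (_ - _).
  by rewrite /msym mmapC.
by rewrite /msym mmapX mmap1U.
Qed.

(** The product of the x_j - z_i over i is killed by phi, so it is not
    invertible and vanishes at a point z of the closed polydisc; then x_j is a
    coordinate of z. *)
Lemma char_roots_le1 (x : 'I_d -> C) :
  (forall p (ps : p \is symmetric), phi (sym_poly_asym ps) = meval x p) ->
  forall j, cmod (x j) <= 1.
Proof.
move=> Hx j; rewrite leNgt; apply/negP => xj.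
have evE v : meval v (\prod_(i < d) (mpolyC d (x j) - mpolyX C (mnm1 i))) =
    \prod_(i < d) (x j - v i).
  rewrite (big_morph _ (@mevalM d C v) (@meval1 d C v)).
    by apply: eq_bigr => i _; rewrite mevalB mevalC mevalXU.
have [|g] := @asym_inverse _ _ (sym_poly_asym (prod_sub_symmetric (x j))).
  move=> z /=; rewrite /peval evE; apply/prodf_neq0 => i _.
  rewrite subr_eq0; apply/eqP => E; move: xj; rewrite E ltNge.
  by rewrite (closed_polydisc_le1 z i).
move=> /(congr1 phi); rewrite (char_mul phiP) (char_one phiP) Hx evE.
by rewrite (bigD1 j)//= subrr !mul0r => /esym/eqP; rewrite oner_eq0.
Qed.

Theorem char_is_eval : exists w : K, forall f, phi f = f w.
Proof.
have [|t Ht] := @esym_roots (fun k => phi (esym_asym k)).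
  by rewrite esym_asym0 (char_one phiP).
have Hp := char_sym_poly Ht.
have wb : polyball d 1 (\row_i tnth t i).
  by move=> j; rewrite mxE; exact: char_roots_le1.
exists (closed_polydisc_point wb) => f; apply: eq_of_cmod_le => e e0.
have e2 : 0 < e / 2 by rewrite divr_gt0.
have [p [ps Hf]] := dense_sym_poly f e2.
have h1 := Hf (closed_polydisc_point wb); have := char_le phiP Hf.
rewrite Hp.
have -> : meval (tnth t) p = sym_poly_asym ps (closed_polydisc_point wb).
  by rewrite /= /peval; apply: meval_eq => i; rewrite mxE.
set a := f _ in h1 *; set b := sym_poly_asym ps _ in h1 *.
have := cmodB (phi f - b) (a - b).
rewrite (_ : _ - _ - _ = phi f - a); last by ring.
lra.
Qed.

End OneChar.

(** The values of the elementary symmetric polynomials are the coefficients of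
    the polynomial with roots z_1, ..., z_d, which determines these roots up to
    order. *)
Theorem eval_separates (z w : K) :
  (forall f : A, f z = f w) <-> perm_equiv z w.
Proof.
split=> [zw|/asboolP[s <-] f]; last by rewrite asym_symmetric.
pose tz := [tuple val z ord0 i | i < d]; pose tw := [tuple val w ord0 i | i < d].
have me (u : K) k : meval (tnth [tuple val u ord0 i | i < d]) (mesym d C k) = esym_asym k u.
  by apply: meval_eq => i; rewrite tnth_mktuple.
have cE (k : nat) : (\prod_(c <- tz) ('X - c%:P))`_k = (\prod_(c <- tw) ('X - c%:P))`_k.
  have [kd|dk] := leqP k d.
    have kd' : (d - k < d.+1)%N by rewrite ltnS leq_subr.
    have := mroots_coeff tz (Ordinal kd'); have := mroots_coeff tw (Ordinal kd').
    by rewrite /= subKn// !me zw => -> ->.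
  by rewrite !nth_default// size_prod_XsubC size_tuple.
have /prod_XsubC_eq/tuple_permP[s Hs] : \prod_(c <- tw) ('X - c%:P) = \prod_(c <- tz) ('X - c%:P).
  by apply/polyP => k; rewrite cE.
apply/asboolP; exists s; apply/val_inj/rowP => i; rewrite mxE.
have : tnth tw i = tnth [tuple tnth tz (s i) | i < d] i by congr tnth; exact/val_inj.
by rewrite !tnth_mktuple.
Qed.

End Evaluation.

(** * The homeomorphism *)

Section General.

(** The preimage of a closed set under f is its image under g, which is
    compact. *)
Lemma compact_hausdorff_inverse (X Y : topologicalType) (f : X -> Y) (g : Y -> X) :
  hausdorff_space X -> compact [set: Y] -> cancel f g -> cancel g f ->
  continuous g -> continuous f.
Proof.
move=> hX cY fK gK cg; apply/continuous_closedP => B cB.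
have -> : f @^-1` B = g @` B.
  apply/seteqP; split=> [x Bfx|_ [y By <-]] /=; last by rewrite gK.
  by exists (f x).
apply: compact_closed => //; apply: continuous_compact.
  exact: continuous_subspaceT.
exact: subclosed_compact cB cY _.
Qed.

Lemma hausdorff_separating (X : topologicalType) (I : Type) (Y : topologicalType)
    (h : I -> X -> Y) : hausdorff_space Y -> (forall i, continuous (h i)) ->
  (forall x y, (forall i, h i x = h i y) -> x = y) -> hausdorff_space X.
Proof.
move=> hY ch sep x y xy; apply: sep => i; apply: hY => U V Ux Vy.
have [z [Uz Vz]] := xy _ _ (ch i x _ Ux) (ch i y _ Vy).
by exists (h i z).
Qed.

Lemma ptws_continuous (I : Type) (X Y : topologicalType) (f : X -> {ptws I -> Y}) :
  (forall i, continuous (fun x => f x i)) -> continuous f.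
Proof.
move=> cf x; apply/cvg_sup => i U [?/= [[W oW <-]]] /= Wfx /filterS; apply.
by apply: cf; exact: open_nbhs_nbhs.
Qed.

End General.

Section Gelfand.
Context {R : realType} {d : nat}.
Local Notation C := (CC R).
Local Notation K := (closed_polydisc C d).
Local Notation A := (Asym C d).
Local Notation G := (gelfand_space A).
Local Notation Q := (polydisc_quotient C d).

Definition gelfand_eval (z : K) : G := SigSub (mem_set (ev_char z : maximal_ideal_space C A (ev z))).

Lemma gelfand_eval_continuous : continuous gelfand_eval.
Proof.
apply: continuous_comp_initial; apply: (@ptws_continuous A K C ev) => f.
by have /sym_polydisc_algebraP [] := Asym_funP f.
Qed.

Lemma gelfand_eval_perm z w : perm_equiv z w <-> gelfand_eval z = gelfand_eval w.
Proof.
rewrite -eval_separates; split => [zw|/(congr1 val) zw f].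
  by apply/val_inj/funext.
exact: (congr1 (fun phi : A -> C => phi f) zw).
Qed.

Lemma gelfand_eval_surj (phi : G) : exists z, gelfand_eval z = phi.
Proof.
have [z zP] := char_is_eval (set_mem (valP phi) : is_char (val phi)).
by exists z; apply/val_inj/funext => f; rewrite zP.
Qed.

Lemma gelfand_hausdorff : hausdorff_space G.
Proof.
apply: (@hausdorff_separating _ A C (fun f (phi : G) => val phi f)).
- exact: norm_hausdorff.
- move=> f phi; apply: (@continuous_comp G {ptws A -> C} C val (fun p => p f)).
    exact: initial_continuous.
  exact: proj_continuous.
by move=> phi psi H; apply/val_inj/funext.
Qed.

Lemma quotient_compact : compact [set: Q].
Proof.
have -> : [set: Q] = \pi_Q%qT @` [set: K].
  apply/seteqP; split => // q _; exists (generic_quotient.repr q) => //; exact: reprK.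
apply: continuous_compact; last exact: compact_closed_polydisc.
exact/continuous_subspaceT/pi_continuous.
Qed.

Theorem gelfand_homeo : homeomorphic G Q.
Proof.
have [z zP] := choice gelfand_eval_surj.
pose g (q : Q) : G := gelfand_eval (generic_quotient.repr q).
pose f (phi : G) : Q := \pi_Q%qT (z phi).
have gpi w : g (\pi_Q%qT w) = gelfand_eval w.
  by apply/gelfand_eval_perm/eqmodP; rewrite /= reprK.
have fg : cancel f g by move=> phi; rewrite /f gpi zP.
have gf : cancel g f.
  move=> q; rewrite /f -[RHS]reprK; apply/eqmodP => /=.
  by apply/gelfand_eval_perm; rewrite zP.
have cg : continuous g.
  apply/quotient_continuous; rewrite (_ : _ \o _ = gelfand_eval); first exact: gelfand_eval_continuous.
  by apply/funext => w /=; rewrite gpi.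
exists f, g; split => //.
exact: compact_hausdorff_inverse gelfand_hausdorff quotient_compact fg gf cg.
Qed.

End Gelfand.

Theorem theorem3p4 (R : realType) (d : nat) (hd : (0 < d)%N) :
  homeomorphic (gelfand_space (Asym R[i] d)) (polydisc_quotient R[i] d).
Proof. exact: (@gelfand_homeo R d). Qed.
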